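(* For every $k\ge3$, testing $T_k$-minor freeness of $N$-vertex graphs in the unbounded-degree incidence-lists model has query complexity $\widetilde{\Theta}(\sqrt{N})$, where the upper bound hides factors polynomial in $k/\epsilon$. More precisely: (i) there is a one-sided error tester with query complexity $\widetilde{O}(\sqrt N)\cdot\mathrm{poly}(k/\epsilon)$ that, whenever it rejects, outputs a $T_k$-minor of size $O(k^2/\epsilon)$; (ii) there is a constant $\epsilon>0$ such that any tester for $T_k$-minor freeness with proximity parameter $\epsilon$, even with two-sided error, must make $\Omega(\sqrt N)$ queries.
   Context: $T_k$ denotes the $k$-star (tree with $k+1$ vertices and $k$ leaves). Unbounded-degree incidence-lists model: a simple graph $G=([N],E)$ is accessed by queries returning the $i$-th neighbor of a vertex $v$ (or $0$ if $v$ has fewer than $i$ neighbors), $i\in[N-1]$, and degree queries; it is assumed that $|E|$ is at least linear in $N$. $G$ is $\epsilon$-far from $T_k$-minor freeness if more than $2\epsilon|E|$ edges must be removed to obtain a $T_k$-minor free graph. A tester accepts graphs with the property with probability at least $2/3$ (probability $1$ for one-sided error) and accepts graphs $\epsilon$-far from it with probability at most $1/3$. $G$ has an $H$-minor if $H$ is obtainable from $G$ by vertex deletions, edge deletions and edge contractions. *)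

(* Defs.v *)
From Stdlib Require Import Relation_Operators.
From mathcomp Require Import all_boot all_order all_algebra.
From mathcomp Require Import all_reals exp.

Set Implicit Arguments.
Unset Strict Implicit.
Unset Printing Implicit Defensive.

Import Order.TTheory GRing.Theory Num.Theory.

(* The vertex set may be a proper subset of [T]: subgraphs of a graph and the
   results of deletions and contractions then live over the same type [T]. *)
Record graph (T : finType) := Graph {
  vset : {set T};
  eset : {set {set T}};
  esetP : forall e, e \in eset -> (e \subset vset) && (#|e| == 2)
}.

Section Minors.
Context {T : finType}.
Implicit Types F G H : graph T.

Definition subgraph F G : Prop :=
  (vset F \subset vset G) && (eset F \subset eset G).

Lemma remove_edges_subproof G (X : {set {set T}}) e :
  e \in eset G :\: X -> (e \subset vset G) && (#|e| == 2).
Proof. by rewrite inE => /andP[_]; apply: esetP. Qed.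

Definition remove_edges G (X : {set {set T}}) : graph T :=
  Graph (@remove_edges_subproof G X).

Definition vertex_deletion G H : Prop :=
  exists2 v, v \in vset G &
    vset H = vset G :\ v /\ eset H = [set e in eset G | v \notin e].

Definition edge_deletion G H : Prop :=
  exists2 e, e \in eset G & vset H = vset G /\ eset H = eset G :\ e.

Definition merge_into (u v x : T) : T := if x == v then u else x.

(* The edge uv is contracted into u; the loop this creates is discarded, and
   parallel edges are identified since [eset] is a set. *)
Definition edge_contraction G H : Prop :=
  exists u v, [/\ [set u; v] \in eset G, vset H = vset G :\ v &
    eset H = [set e in [set merge_into u v @: e0 | e0 : {set T} in eset G]
             | #|e| == 2]].

Definition minor_step G H : Prop :=
  [\/ vertex_deletion G H, edge_deletion G H | edge_contraction G H].

Definition isomorphic {T' : finType} G (H : graph T') : Prop :=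
  exists f : T -> T',
    [/\ {in vset G &, injective f}, f @: vset G = vset H &
        [set f @: e | e : {set T} in eset G] = eset H].

Definition has_minor {T' : finType} (H : graph T') G : Prop :=
  exists2 G', clos_refl_trans _ minor_step G G' & isomorphic G' H.

(* [F] is an H-minor found in [G]: a subgraph of [G] that contracts to [H]. *)
Definition is_minor_of {T' : finType} (H : graph T') F G : Prop :=
  subgraph F G /\
  exists2 F', clos_refl_trans _ edge_contraction F F' & isomorphic F' H.

Definition gsize G : nat := #|vset G| + #|eset G|.

End Minors.

Lemma star_subproof k e :
  e \in [set [set ord0; i] | i : 'I_k.+1 in [set~ ord0]] ->
  (e \subset [set: 'I_k.+1]) && (#|e| == 2).
Proof.
by move=> /imsetP[i + ->]; rewrite !inE subsetT cards2 eq_sym => ->.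
Qed.

Definition star k : graph 'I_k.+1 := Graph (@star_subproof k).

Definition star_minor_free (T : finType) k (G : graph T) : Prop :=
  ~ has_minor (star k) G.

Definition far_from_star_minor_free (R : realType) (T : finType) k (eps : R)
    (G : graph T) : Prop :=
  forall X : {set {set T}}, X \subset eset G ->
    star_minor_free k (remove_edges G X) ->
    (2 * eps * #|eset G|%:R < #|X|%:R)%R.

(* A graph on [N] given by its incidence lists, whose order is arbitrary. *)
Record input N := Input {
  igraph : graph 'I_N;
  nbrs : 'I_N -> seq 'I_N;
  igraph_full : vset igraph = [set: 'I_N];
  nbrs_uniq : forall v, uniq (nbrs v);
  mem_nbrs : forall v w, (w \in nbrs v) = ([set v; w] \in eset igraph)
}.

(* [Nbr v i] asks for the (i+1)-st neighbor of v, i = 0, ..., N-2; the answer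
   [None] says that v has fewer than i+1 neighbors. *)
Inductive query N := Nbr of 'I_N & 'I_N.-1 | Deg of 'I_N.

Definition answer N (q : query N) : Type :=
  match q with Nbr _ _ => option 'I_N | Deg _ => nat end.

Definition reply N (x : input N) (q : query N) : answer q :=
  match q with
  | Nbr v i => onth (nbrs x v) i
  | Deg v => size (nbrs x v)
  end.

(* Deterministic adaptive algorithms for N-vertex graphs. *)
Inductive dalg N (A : Type) :=
  | Output of A
  | Ask (q : query N) of (answer q -> dalg N A).

Fixpoint eval N A (t : dalg N A) (x : input N) : A :=
  match t with
  | Output a => a
  | Ask q next => eval (next (reply x q)) x
  end.

Fixpoint nqueries N A (t : dalg N A) (x : input N) : nat :=
  match t with
  | Output _ => 0
  | Ask q next => (nqueries (next (reply x q)) x).+1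
  end.

Local Open Scope ring_scope.

Record ralg (R : realType) N (A : Type) := RAlg {
  seed : finType;
  prob : seed -> R;
  prob_ge0 : forall w, 0 <= prob w;
  prob_sum1 : \sum_w prob w = 1;
  run : seed -> dalg N A
}.

Section Testers.
Context {R : realType} {N : nat} {A : Type}.
Variables (c : R) (k : nat) (eps : R) (acc : pred A) (M : ralg R N A).

(* The model only admits graphs with at least c * N edges. *)
Definition admissible (x : input N) : Prop :=
  c * N%:R <= #|eset (igraph x)|%:R.

Definition accept_prob (x : input N) : R :=
  \sum_(w : seed M | acc (eval (run w) x)) prob w.

Definition star_minor_tester : Prop :=
  forall x, admissible x ->
    (star_minor_free k (igraph x) -> 2 / 3 <= accept_prob x) /\
    (far_from_star_minor_free k eps (igraph x) -> accept_prob x <= 1 / 3).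

Definition one_sided : Prop :=
  forall x, admissible x -> star_minor_free k (igraph x) -> accept_prob x = 1.

Definition makes_at_most (q : R) : Prop :=
  forall x, admissible x ->
    forall w : seed M, 0 < prob w -> (nqueries (run w) x)%:R <= q.

End Testers.

(* The output [None] means accept, [Some F] means reject and exhibit [F]. *)
Definition accepts A (o : option A) : bool := ~~ isSome o.

Definition rejects_with_star_minor (R : realType) N (c : R) (k : nat) (s : R)
    (M : ralg R N (option (graph 'I_N))) : Prop :=
  forall x, admissible c x ->
    forall w : seed M, 0 < prob w ->
    forall F, eval (run w) x = Some F ->
      is_minor_of (star k) F (igraph x) /\ (gsize F)%:R <= s.

(* Main.v *)
(* A graph has a T_k-minor iff it contains a tree together with k further
   vertices adjacent to it ([star_model]): this property lifts through
   contractions, and conversely the tree contracts to the centre of a star.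

   Upper bound.  The tester runs O(k sqrt N / eta) breadth-first searches of
   depth O(k / eta) from random vertices, eta = eps * min c 1, reading at most k
   neighbours of each vertex.  Call a vertex clean if its search exhibits no small
   T_k-minor; then all BFS layers around it have fewer than k vertices, also
   inside any induced subgraph.  If layers i and i+1 have s_i and s_(i+1)
   vertices, they are joined by at most s_i s_(i+1) edges; if this exceeded
   eta times the size of the ball at every depth, the balls would grow
   quadratically, contradicting s_i < k.  So a T_k-minor-free ball around a clean
   vertex can be cut off at a cost of eta edges per vertex.  Deleting first all
   edges at the set W of unclean vertices costs at most k |W| + |W|^2 edges, since
   a vertex of degree >= k is not adjacent to a clean one.  Hence a far graph has
   |W| of order sqrt N at least, and some search succeeds.

   Lower bound.  An N-cycle is T_3-minor-free, but planting a clique on one of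
   sqrt N disjoint blocks of sqrt N vertices makes it far.  A tester has to query
   each of the blocks with probability at least 1/3. *)
Require Import Defs.
From Stdlib Require Import Relation_Operators.
From mathcomp Require Import all_boot all_order all_algebra.
From mathcomp Require Import boolp all_reals exp.
From mathcomp Require Import zify ring lra.

Set Implicit Arguments.
Unset Strict Implicit.
Unset Printing Implicit Defensive.

Import Order.TTheory GRing.Theory Num.Theory.

(** * Star minors as trees with leaves *)

Section StarModels.
Context {T : finType}.
Implicit Types (S P L : {set T}) (E : {set {set T}}) (F G H : graph T).

Lemma graph_ext G H : vset G = vset H -> eset G = eset H -> G = H.
Proof.
case: G H => [V E p] [V' E' p'] /= eqV eqE; subst V' E'.
by rewrite (Prop_irrelevance p p').
Qed.

Lemma disjoint_setU1 w S P :
  [disjoint w |: S & P] = (w \notin P) && [disjoint S & P].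
Proof. by rewrite !disjoints_subset subUset sub1set inE. Qed.

(** Trees are generated by attaching leaves, so induction peels off the last leaf [w]; contracting
    its edge into [u] is the inductive step of [tree_contract]. *)
Inductive tree : {set T} -> {set {set T}} -> Prop :=
| tree_vertex v : tree [set v] set0
| tree_leaf S E u w of tree S E & u \in S & w \notin S :
    tree (w |: S) ([set u; w] |: E).

(** [S] is nonempty and connected in [E]. Asking for a spanning tree keeps the number of edges of an
    extracted minor linear in [#|S|]. *)
Definition connects E S := exists2 E', tree S E' & E' \subset E.

(** [E] is a bare edge set so that the notion applies alike to a graph, to what remains after
    removing edges, and to the edges seen by a search. *)
Definition star_model k E S L :=
  [/\ connects E S, [disjoint S & L], k <= #|L| &
      {in L, forall l, exists2 u, u \in S & [set u; l] \in E}].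

Lemma pair_edge G u w : [set u; w] \in eset G ->
  [/\ u \in vset G, w \in vset G & u != w].
Proof.
move=> /esetP/andP[/subsetP sub]; rewrite cards2 eqSS eqb1 => ->.
by split=> //; apply: sub; rewrite !inE eqxx ?orbT.
Qed.

Lemma tree_edge S E e : tree S E -> e \in E -> (e \subset S) && (#|e| == 2).
Proof.
elim=> [v|S' E' u w _ IH Su Sw]; first by rewrite inE.
rewrite !inE => /orP[/eqP->|/IH/andP[eS ->]].
  rewrite subUset !sub1set !inE Su eqxx orbT /= cards2.
  by have ->: u != w by apply: contraNneq Sw => <-.
by rewrite andbT (subset_trans eS) // subsetUr.
Qed.

Lemma card_tree S E : tree S E -> #|E| < #|S|.
Proof.
elim=> [v|S' E' u w _ IH Su Sw]; first by rewrite cards0 cards1.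
by rewrite !cardsU1 Sw ltnS; case: (_ \notin E'); rewrite // ltnW.
Qed.

Lemma tree_neq0 S E : tree S E -> S != set0.
Proof. by move/card_tree => h; rewrite -card_gt0; apply: leq_ltn_trans h. Qed.

Lemma connects1 E v : connects E [set v].
Proof. by exists set0; [apply: tree_vertex|apply: sub0set]. Qed.

Lemma connectsU1 E S u w :
  connects E S -> u \in S -> [set u; w] \in E -> connects E (w |: S).
Proof.
move=> [E' tE sE] Su uw; case: (boolP (w \in S)) => Sw.
  by rewrite setUC (setUidPl _) ?sub1set //; exists E'.
exists ([set u; w] |: E'); first exact: tree_leaf.
by rewrite subUset sub1set uw.
Qed.

Lemma connectsU E S P : connects E S ->
  {in P, forall w, w \in S \/ exists2 u, u \in S & [set u; w] \in E} ->
  connects E (S :|: P).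
Proof.
elim: {P}#|P| {-2}P (eqxx #|P|) => [|n IH] P.
  by rewrite cards_eq0 => /eqP-> cS _; rewrite setU0.
move=> cP cS adj; have /card_gt0P[w Pw]: 0 < #|P| by rewrite (eqP cP).
have {}IH: connects E (S :|: P :\ w).
  apply: IH => //; first by move: cP; rewrite (cardsD1 w) Pw.
  by move=> z; rewrite !inE => /andP[_]; apply: adj.
rewrite -(setD1K Pw) setUCA.
case: (adj w Pw) => [Sw|[u Su uw]]; last first.
  by apply: (connectsU1 (u := u)); rewrite // inE Su.
by rewrite setUC (setUidPl _) // sub1set inE Sw.
Qed.

Lemma connectsS E E' S : E \subset E' -> connects E S -> connects E' S.
Proof. by move=> sE [F tF /subset_trans sF]; exists F; rewrite // sF. Qed.

Lemma connects_closed E S P :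
  {in S &, forall x y, [set x; y] \in E -> (x \in P) = (y \in P)} ->
  connects E S -> S \subset P \/ [disjoint S & P].
Proof.
move=> clP [E' tE]; elim: tE clP => [v _ _|S' F u w _ IH Su Sw clP].
  by rewrite sub1set disjoints1; case: (v \in P); [left|right].
rewrite (subUset E) sub1set => /andP[uw sF].
have uPw : (u \in P) = (w \in P) by apply: clP uw; rewrite !inE ?eqxx ?Su ?orbT.
case: IH => // [x y Sx Sy|SP|dSP].
- by apply: clP; rewrite inE (Sx, Sy) orbT.
- by left; rewrite subUset SP sub1set -uPw (subsetP SP).
by right; rewrite disjoint_setU1 dSP -uPw (disjointFr dSP Su).
Qed.

(** Induction on the tree: contracting its last leaf [w] into [u] leaves a graph of the same shape
    over the smaller tree, until a single vertex [v] remains. The map [p] gives each leaf of the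
    star its one attachment point. *)
Lemma tree_contract S E L (p : T -> T) F :
  tree S E -> [disjoint S & L] -> {in L, forall l, p l \in S} ->
  vset F = S :|: L -> eset F = E :|: [set [set p l; l] | l in L] ->
  exists v F', [/\ clos_refl_trans _ edge_contraction F F', v \notin L,
    vset F' = v |: L & eset F' = [set [set v; l] | l in L]].
Proof.
move=> tE; elim: tE p F => [v|S' E' u w tE IH Su Sw] p F dSL pS vF eF.
  exists v, F; split=> //; first exact: rt_refl.
    by move: dSL; rewrite disjoints1.
  rewrite eF set0U; apply: eq_in_imset => l Ll.
  by move: (pS l Ll); rewrite inE => /eqP->.
move: dSL; rewrite disjoint_setU1 => /andP[Lw dSL].
(* Star leaves attached at [w] hang on [u] after the contraction. *)
pose p' l := merge_into u w (p l).
have p'S: {in L, forall l, p' l \in S'}.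
  move=> l Ll; rewrite /p' /merge_into; case: eqP => // /eqP pw.
  by move: (pS l Ll); rewrite !inE (negPf pw).
have Hp e : e \in E' :|: [set [set p' l; l] | l in L] ->
    (e \subset S' :|: L) && (#|e| == 2).
  rewrite inE => /orP[/(tree_edge tE)/andP[eS ->]|/imsetP[l Ll ->]].
    by rewrite andbT (subset_trans eS) ?subsetUl.
  rewrite subUset !sub1set !inE p'S // Ll orbT cards2 /=.
  by case: (p' l =P l) => // pl; move: (disjointFr dSL (p'S l Ll)); rewrite pl Ll.
pose H := Graph Hp.
have [v [F' [HF' vL vF' eF']]] := IH p' H dSL p'S erefl erefl.
exists v, F'; split=> //; apply: rt_trans HF'; apply: rt_step.
have mE e : e \in E' -> merge_into u w @: e = e.
  move=> /(tree_edge tE)/andP[/subsetP eS _]; rewrite -[RHS]imset_id.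
  apply: eq_in_imset => z /eS Sz; rewrite /merge_into; case: eqP Sz => // ->.
  by rewrite (negPf Sw).
have mL l : l \in L -> merge_into u w @: [set p l; l] = [set p' l; l].
  move=> Ll; rewrite imsetU !imset_set1; congr [set _; _].
  by rewrite /merge_into; case: eqP Ll => // ->; rewrite (negPf Lw).
exists u, w; split.
- by rewrite eF !inE eqxx.
- rewrite vF /=; apply/setP=> z; rewrite !inE; case: eqP => //= ->.
  by rewrite (negPf Sw) (negPf Lw).
apply/setP=> e /=; rewrite [RHS]inE; apply/idP/andP.
  move=> He; have /andP[_ ->] := Hp _ He; split=> //.
  move: He; rewrite inE => /orP[eE|/imsetP[l Ll ->]]; apply/imsetP.
    by exists e; rewrite ?mE // eF !inE eE orbT.
  exists [set p l; l]; rewrite ?mL // eF inE; apply/orP; right.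
  exact: imset_f.
move=> [/imsetP[e0 + ->]]; rewrite eF !inE => /orP[/orP[/eqP->|eE]|].
- by rewrite imsetU !imset_set1 /merge_into eqxx if_same setUid cards1.
- by rewrite mE // eE.
move=> /imsetP[l Ll ->] _; rewrite mL //; apply/orP; right.
exact: imset_f.
Qed.

Lemma star_isomorphic v L F : v \notin L -> vset F = v |: L ->
  eset F = [set [set v; l] | l in L] -> isomorphic F (star #|L|).
Proof.
move=> vL vF eF.
pose f x : 'I_#|L|.+1 := if x == v then ord0 else inord (index x (enum L)).+1.
have fv : f v = ord0 by rewrite /f eqxx.
have fL l : l \in L -> f l = (index l (enum L)).+1 :> nat.
  move=> Ll; rewrite /f; case: eqP Ll => [->|_] Ll; first by rewrite Ll in vL.
  by rewrite inordK // ltnS cardE index_mem mem_enum.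
have f0 l : l \in L -> f l != ord0.
  by move=> /fL fl; rewrite -val_eqE /= fl.
have fi : {in vset F &, injective f}.
  rewrite vF => x y; rewrite !inE => /orP[/eqP->|Lx] /orP[/eqP->|Ly] //.
  - by rewrite fv => /esym/eqP; rewrite (negPf (f0 _ Ly)).
  - by rewrite fv => /eqP; rewrite (negPf (f0 _ Lx)).
  move=> /(congr1 val); rewrite /= !fL // => -[eqi].
  have lx z : z \in L -> z \in enum L by rewrite mem_enum.
  by rewrite -(nth_index x (lx _ Lx)) eqi nth_index ?lx.
have fT : f @: vset F = setT.
  apply/eqP; rewrite eqEcard subsetT cardsT card_ord (card_in_imset fi) vF.
  by rewrite cardsU1 vL add1n leqnn.
exists f; split=> //; rewrite eF -imset_comp.
apply/setP=> e; apply/imsetP/imsetP => [[l Ll ->]|[i]] /=.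
  by exists (f l); rewrite ?inE ?f0 // imsetU !imset_set1 fv.
rewrite !inE => i0 ->; have: i \in f @: vset F by rewrite fT inE.
move=> /imsetP[x]; rewrite vF !inE => /orP[/eqP->|Lx ix].
  by rewrite fv => i_0; rewrite i_0 in i0.
by exists x => //=; rewrite ix imsetU !imset_set1 fv.
Qed.

(** Only a spanning tree of [S] and [k] leaves with one edge each are kept: at most [#|S| + k]
    vertices and as many edges. *)
Lemma star_model_contracts k E S L : star_model k E S L ->
  exists F, [/\ eset F \subset E,
    (exists2 F', clos_refl_trans _ edge_contraction F F' &
       isomorphic F' (star k)) &
    (gsize F <= 2 * (#|S| + k))%N].
Proof.
case=> -[E0 tE sE] dSL kL adj.
have [L0 [sL cL]] : exists L0 : {set T}, L0 \subset L /\ #|L0| = k.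
  have [A [sA uA eA]] : exists A : seq T, [/\ {subset A <= L}, uniq A & size A = k].
    exists (take k (enum L)); split.
    - by move=> z /mem_take; rewrite mem_enum.
    - exact/take_uniq/enum_uniq.
    - by rewrite size_takel // -cardE.
  exists [set z in A]; split; first by apply/subsetP=> z; rewrite inE => /sA.
  by rewrite cardsE -eA; apply/card_uniqP.
have [p pP] : exists p : T -> T, {in L0, forall l, p l \in S /\ [set p l; l] \in E}.
  have ex l : exists u, l \in L0 -> u \in S /\ [set u; l] \in E.
    case: (boolP (l \in L0)) => [/(subsetP sL)/adj[u Su uE]|_]; last by exists l.
    by exists u.
  by have [p pP] := choice ex; exists p.
have {}dSL : [disjoint S & L0] by exact: disjointWr sL dSL.
have Fp e : e \in E0 :|: [set [set p l; l] | l in L0] ->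
    (e \subset S :|: L0) && (#|e| == 2).
  rewrite inE => /orP[/(tree_edge tE)/andP[eS ->]|/imsetP[l Ll ->]].
    by rewrite andbT (subset_trans eS) ?subsetUl.
  have [Sp _] := pP l Ll; rewrite subUset !sub1set !inE Sp Ll orbT cards2 /=.
  by case: (p l =P l) => // pl; move: (disjointFr dSL Sp); rewrite pl Ll.
exists (Graph Fp); split=> /=.
- rewrite subUset sE; apply/subsetP=> e /imsetP[l Ll ->].
  by have [] := pP l Ll.
- have [|v [F' [cF vL vF eF]]] := @tree_contract _ _ _ p (Graph Fp) tE dSL _ erefl erefl.
    by move=> l /pP[].
  by exists F' => //; rewrite -cL; apply: star_isomorphic eF.
rewrite /gsize /= mul2n -addnn leq_add //.
  by rewrite -cL cardsU leq_subr.
apply: leq_trans (leq_card_setU _ _).1 _; apply: leq_add.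
  exact/ltnW/card_tree.
by rewrite -cL leq_imset_card.
Qed.

Lemma subgraph_minor F G : subgraph F G -> clos_refl_trans _ minor_step G F.
Proof.
move=> /andP[sV sE].
have delE n G1 : #|eset G1 :\: eset F| = n -> vset G1 = vset G ->
    eset F \subset eset G1 -> exists2 G2, clos_refl_trans _ minor_step G1 G2 &
      vset G2 = vset G /\ eset G2 = eset F.
  elim: n G1 => [|n IH] G1 cG vG sG.
    exists G1; first exact: rt_refl.
    split=> //; apply/eqP; rewrite eqEsubset sG andbT -setD_eq0.
    by rewrite -cards_eq0 cG.
  have /card_gt0P[e] : 0 < #|eset G1 :\: eset F| by rewrite cG.
  rewrite inE => /andP[eF eG]; pose G2 := remove_edges G1 [set e].
  have [|//||G3 st G3P] := IH G2.
  - rewrite /G2 /= setDDl setUC -setDDl; move: cG.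
    by rewrite (cardsD1 e) !inE eF eG => -[].
  - by rewrite /G2 /= subsetD1 sG.
  exists G3 => //; apply: rt_trans st; apply: rt_step.
  by apply: Or32; exists e.
have delV n G1 : #|vset G1 :\: vset F| = n -> eset G1 = eset F ->
    vset F \subset vset G1 -> clos_refl_trans _ minor_step G1 F.
  elim: n G1 => [|n IH] G1 cG eG sG.
    rewrite (_ : G1 = F); first exact: rt_refl.
    apply: graph_ext eG; apply/eqP; rewrite eqEsubset sG andbT -setD_eq0.
    by rewrite -cards_eq0 cG.
  have /card_gt0P[v] : 0 < #|vset G1 :\: vset F| by rewrite cG.
  rewrite inE => /andP[vF vG].
  have Hp e : e \in eset F -> (e \subset vset G1 :\ v) && (#|e| == 2).
    move=> /esetP/andP[eV ->]; rewrite andbT subsetD1 (subset_trans eV sG).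
    by apply: contra vF; apply: (subsetP eV).
  pose G2 := Graph Hp; apply: (rt_trans _ _ _ G2).
    apply: rt_step; apply: Or31; exists v => //; split=> //=.
    apply/setP=> e; rewrite inE eG; case: (boolP (e \in eset F)) => //= eF.
    have /andP[/subsetP sub _] := Hp e eF.
    by case: (boolP (v \in e)) => // /sub; rewrite !inE eqxx.
  apply: IH => //=; last by rewrite subsetD1 sG.
  rewrite setDDl setUC -setDDl; move: cG.
  by rewrite (cardsD1 v) !inE vF vG => -[].
have [//|G2 st [vG eG]] := delE _ G erefl erefl.
by apply: rt_trans st _; apply: delV; rewrite // vG.
Qed.

Lemma minor_of_has_minor {T' : finType} (H : graph T') F G :
  is_minor_of H F G -> has_minor H G.
Proof.
move=> [/subgraph_minor GF [F' cF iF]]; exists F' => //; apply: rt_trans GF _.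
elim: cF => [x y c|x|x y z _ xy _ yz]; [|exact: rt_refl|exact: rt_trans yz].
by apply: rt_step; apply: Or33.
Qed.

Lemma star_model_has_minor k G S L :
  vset G = setT -> star_model k (eset G) S L -> has_minor (star k) G.
Proof.
move=> vG /star_model_contracts[F [sF cF _]].
by apply: (@minor_of_has_minor _ _ F); split; rewrite // /subgraph vG subsetT.
Qed.

Lemma star_modelS k E E' S L :
  E \subset E' -> star_model k E S L -> star_model k E' S L.
Proof.
move=> sE [cS dSL kL adj]; split=> //; first exact: connectsS cS.
by move=> l /adj[u Su uE]; exists u => //; apply: (subsetP sE).
Qed.

(** A one-vertex tree uses no edge and could lie outside the graph; [0 < k] supplies a leaf, whose
    edge puts one vertex of [S], hence by connectedness all of [S], inside. *)
Lemma star_model_vset k G S L :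
  0 < k -> star_model k (eset G) S L -> S \subset vset G.
Proof.
move=> k0 [cS _ kL adj].
have /card_gt0P[l /adj[u Su /pair_edge[Vu _ _]]] := leq_trans k0 kL.
have [|//|d] := connects_closed (P := vset G) _ cS.
  by move=> x y _ _ /pair_edge[-> ->].
by rewrite (disjointFr d Su) in Vu.
Qed.

Lemma set2_eq (U : finType) (a b x y : U) : [set a; b] = [set x; y] ->
  a = x /\ b = y \/ a = y /\ b = x.
Proof.
move=> eq2.
have: a \in [set x; y] by rewrite -eq2 !inE eqxx.
have: b \in [set x; y] by rewrite -eq2 !inE eqxx orbT.
have: x \in [set a; b] by rewrite eq2 !inE eqxx.
have: y \in [set a; b] by rewrite eq2 !inE eqxx orbT.
by move=> /set2P[]hy /set2P[]hx /set2P[]hb /set2P[]ha; subst; auto.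
Qed.

(** * Lifting star models along a map whose fibres are cliques *)

Section Lift.
Variables (f : T -> T) (E E' : {set {set T}}).
Hypothesis lift_edge : forall x y, [set x; y] \in E' ->
  exists x' y', [/\ f x' = x, f y' = y & [set x'; y'] \in E].
Hypothesis fibre_edge : forall x y, f x = f y -> x = y \/ [set x; y] \in E.

(** Each tree edge lifts to an edge between two fibres, and the rest of the newly reached fibre is
    adjacent to the endpoint [w']. *)
Lemma connects_lift S : S \subset f @: setT ->
  connects E' S -> connects E (f @^-1: S).
Proof.
move=> sS [E0 tE0 sE0]; elim: tE0 sS sE0 => [s|S' E1 u w _ IH Su Sw].
  rewrite sub1set => /imsetP[z _ ->] _.
  have -> : f @^-1: [set f z] = [set z] :|: f @^-1: [set f z].
    by apply/setP=> y; rewrite !inE; case: (y =P z) => [->|]; rewrite ?eqxx.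
  apply: connectsU (connects1 _ _) _ => y; rewrite !inE => /eqP/esym/fibre_edge.
  by case=> [->|zy]; [left|right; exists z; rewrite ?inE].
rewrite !subUset !sub1set => /andP[_ sS] /andP[uw sE1].
have {}IH := IH sS sE1.
have [u' [w' [fu fw uw']]] := lift_edge uw.
have Su' : u' \in f @^-1: S' by rewrite inE fu.
have -> : f @^-1: (w |: S') = (w' |: f @^-1: S') :|: f @^-1: [set w].
  by apply/setP=> y; rewrite !inE orbAC; case: (y =P w') => [->|]; rewrite ?fw ?eqxx.
apply: connectsU (connectsU1 IH Su' uw') _ => y.
rewrite !inE -{1}fw => /eqP/esym/fibre_edge[->|w'y]; first by left; rewrite eqxx.
by right; exists w'; rewrite ?inE ?eqxx.
Qed.

(** The tree is replaced by its preimage and each leaf by one chosen preimage; these stay distinct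
    because [f] maps them back to distinct leaves. *)
Lemma star_model_lift k S L : S \subset f @: setT ->
  star_model k E' S L -> exists S' L', star_model k E S' L'.
Proof.
move=> sS [cS dSL kL adj].
have ex l : exists l', l \in L ->
    f l' = l /\ exists2 u, u \in f @^-1: S & [set u; l'] \in E.
  case: (boolP (l \in L)) => [/adj[u Su /lift_edge[u' [l' [fu fl ul]]]]|_].
    by exists l' => _; split=> //; exists u'; rewrite // inE fu.
  by exists l.
have [g gP] := choice ex.
exists (f @^-1: S), (g @: L); split.
- exact: connects_lift.
- rewrite disjoint_sym disjoints_subset; apply/subsetP=> _ /imsetP[l Ll ->].
  by have [fl _] := gP l Ll; rewrite !inE fl (disjointFl dSL Ll).
- rewrite card_in_imset // => l1 l2 /gP[f1 _] /gP[f2 _] eg.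
  by rewrite -f1 -f2 eg.
by move=> _ /imsetP[l Ll ->]; have [] := gP l Ll.
Qed.

End Lift.

(** Deletions only shrink the edge set. A contraction is the map [merge_into a b], whose nonempty
    fibres are single vertices or the two ends of the contracted edge. *)
Lemma minor_step_star_model k G H S L : 0 < k -> minor_step G H ->
  star_model k (eset H) S L -> exists S' L', star_model k (eset G) S' L'.
Proof.
move=> k0 + mH; have sH := star_model_vset k0 mH; case.
- move=> [v _ [_ eH]]; exists S, L; apply: star_modelS mH.
  by rewrite eH; apply/subsetP=> e; rewrite inE => /andP[].
- move=> [e _ [_ eH]]; exists S, L; apply: star_modelS mH.
  by rewrite eH subD1set.
move=> [a [b [ab vH eH]]]; apply: (star_model_lift (f := merge_into a b)) mH.
- move=> x y; rewrite eH inE => /andP[/imsetP[e0 e0G xy] _].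
  have /andP[_ /cards2P[p [q [pq e0E]]]] := esetP e0G.
  move: xy; rewrite e0E imsetU !imset_set1 => /set2_eq[][-> ->].
    by exists p, q; rewrite -e0E.
  by exists q, p; rewrite setUC -e0E.
- move=> x y; rewrite /merge_into.
  case: (x =P b) => [->|_]; case: (y =P b) => [->|_]; first by left.
  + by move=> <-; right; rewrite setUC.
  + by move=> ->; right.
  by left.
(* The fibre of [b] is empty, but [b] is not a vertex of [H], so [S] avoids it. *)
apply/subsetP=> s /(subsetP sH); rewrite vH !inE => /andP[sb _].
by apply/imsetP; exists s; rewrite // /merge_into (negPf sb).
Qed.

Lemma isomorphic_star_model k G : isomorphic G (star k) ->
  exists S L, star_model k (eset G) S L.
Proof.
move=> [f [fi fV fE]].
have: ord0 \in f @: vset G by rewrite fV inE.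
move=> /imsetP[v Vv fv].
exists [set v], (vset G :\ v); split.
- exact: connects1.
- by rewrite disjoints1 !inE eqxx.
- have := card_in_imset fi; rewrite fV cardsT card_ord (cardsD1 v) Vv.
  by case=> ->.
move=> l; rewrite !inE => /andP[lv Vl]; exists v; rewrite ?inE //.
have fl : f l != ord0.
  by apply: contra_neq lv => fl; apply: fi; rewrite // fl.
have : [set ord0; f l] \in eset (star k) by apply: imset_f; rewrite !inE.
rewrite -fE => /imsetP[e eG]; have /andP[eV /cards2P[p [q [pq eE]]]] := esetP eG.
have [Vp Vq] : p \in vset G /\ q \in vset G.
  by split; apply: (subsetP eV); rewrite eE !inE eqxx ?orbT.
rewrite eE imsetU !imset_set1 fv => /set2_eq[][/fi vp /fi lq].
  by rewrite vp // lq // -eE.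
by rewrite vp // lq // setUC -eE.
Qed.

Lemma has_minor_star_model k G : 0 < k -> has_minor (star k) G ->
  exists S L, star_model k (eset G) S L.
Proof.
move=> k0 [G' st /isomorphic_star_model].
elim: st => [x y xy [S [L]]|//|x y z _ xy _ yz /yz/xy //].
exact: minor_step_star_model.
Qed.

(** When the tree grows by [w], the vertex [w] leaves the boundary and at most one neighbour of [w]
    other than [u] enters it. This is what excludes stars with three leaves in a cycle. *)
Lemma connects_boundary2 E S : (forall u, #|[set w | [set u; w] \in E]| <= 2) ->
  connects E S ->
  #|[set w | w \notin S & [exists u in S, [set u; w] \in E]]| <= 2.
Proof.
move=> deg [E0 tE0]; elim: tE0 => [v _|S' E1 u w _ IH Su Sw].
  apply: leq_trans (subset_leq_card _) (deg v); apply/subsetP=> w.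
  by rewrite !inE => /andP[_ /exists_inP[u]]; rewrite inE => /eqP->.
rewrite subUset sub1set => /andP[uw /IH {}IH].
set B := (X in #|pred_of_set X| <= 2) in IH.
have Bw : w \in B by rewrite !inE Sw; apply/exists_inP; exists u.
have uN : u \in [set z | [set w; z] \in E] by rewrite inE setUC.
have := deg w; rewrite (cardsD1 u) uN; move: IH.
rewrite (cardsD1 w) Bw !add1n !ltnS.
move=> h1 h2; apply: leq_trans (leq_add h1 h2).
apply: leq_trans (leq_card_setU _ _).1; apply/subset_leq_card/subsetP=> z.
rewrite !inE negb_or => /andP[/andP[zw Sz] /exists_inP[y]].
rewrite !inE => /orP[/eqP->|Sy] yz.
  by rewrite yz; case: (z =P u) Sz => [->|]; rewrite ?Su ?orbT.
by rewrite zw Sz /=; apply/orP; left; apply/exists_inP; exists y.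
Qed.

End StarModels.

(** * Decomposition around clean vertices *)

Lemma card_bigcup_leq (I T : finType) (A : {set I}) (F : I -> {set T}) k :
  (forall i, #|F i| <= k) -> #|\bigcup_(i in A) F i| <= #|A| * k.
Proof.
move=> Fk; rewrite -sum_nat_const.
apply: (big_ind2 (fun (B : {set T}) n => #|B| <= n)) => // [|B b B' b' hB hB'].
  by rewrite cards0.
exact: leq_trans (leq_card_setU _ _).1 (leq_add hB hB').
Qed.

(** * Quadratic growth of balls with large cuts *)

Section LayerGrowth.
Local Open Scope ring_scope.
Variable R : realType.

(** Here [d i] counts the vertices of the first [i] layers. If every cut were too large, consecutive
    layers would satisfy [a * b > eta * d], forcing [d (2 * j).+1] to be at least [eta * j ^ 2 / 4];
    at [j = J] a product of two layers would exceed [k ^ 2]. *)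
Lemma layer_growth (eta : R) (k J : nat) (d s : nat -> nat) :
  0 < eta -> eta <= 1 -> 2 * k%:R <= eta * J%:R -> (0 < d 1)%N ->
  (forall i, d i.+1 = (d i + s i)%N) ->
  (forall i, (i <= (2 * J).+1)%N -> (s i < k)%N) ->
  exists2 i, (i <= 2 * J)%N & (s i * s i.+1)%:R <= eta * (d i.+1)%:R.
Proof.
move=> e0 e1 kJ d1 dS sk; apply: contrapT => noi.
have big i : (i <= 2 * J)%N -> eta * (d i.+1)%:R < (s i)%:R * (s i.+1)%:R.
  move=> iJ; rewrite -natrM ltNge; apply/negP => le_i.
  by apply: noi; exists i.
(* AM-GM: (s_(2j+1) + s_(2j+2))^2 >= 4 eta d_(2j+1) >= (eta j)^2. *)
have grow j : (j <= J)%N -> 1 <= (d (2 * j).+1)%:R :> R /\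
    eta * j%:R ^+ 2 <= 4 * (d (2 * j).+1)%:R.
  elim: j => [_|j IH jJ].
    by rewrite muln0 expr0n mulr0 mulr_ge0 // ler1n.
  have [d1' dj] := IH (ltnW jJ).
  have -> : (d (2 * j.+1).+1 = d (2 * j).+1 + (s (2 * j).+1 + s (2 * j).+2))%N.
    by rewrite mulnS add2n !dS addnA.
  have lt := big (2 * j).+1 _; move/(_ ltac:(lia)) in lt.
  rewrite dS natrD in lt.
  move: lt; rewrite !natrD -[j.+1]addn1 natrD.
  set D := (d _)%:R in d1' dj *; set a := (s _)%:R; set b := (s _)%:R => lt.
  have a0 : 0 <= a by apply: ler0n.
  have b0 : 0 <= b by apply: ler0n.
  have j0 : 0 <= j%:R :> R by apply: ler0n.
  split; first by lra.
  have ab0 : 0 < a * b by nra.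
  have t1 : 1 <= a + b.
    have : (0 < s (2 * j).+1)%N.
      rewrite -(ltr0n R) lt_neqAle a0 andbT; apply: contraTneq ab0.
      by rewrite /a => <-; rewrite mul0r ltxx.
    by rewrite -(ler1n R) => a1; rewrite -/a in a1; lra.
  have t2 : eta * j%:R <= a + b.
    have h1 : eta * (eta * j%:R ^+ 2) <= eta * (4 * D) by rewrite ler_pM2l.
    have h2 : 0 <= (a - b) ^+ 2 by apply: sqr_ge0.
    have h3 : 0 <= eta * a by rewrite mulr_ge0 // ltW.
    have h4 : 0 <= eta * j%:R by rewrite mulr_ge0 // ltW.
    by rewrite -(ler_pXn2r (n := 2)) ?nnegrE ?addr_ge0 //; lra.
  (* Of [4 * (a + b)], one half covers [2 * (eta * j)] by [t2], the other covers [eta] by [t1]. *)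
  have -> : eta * (j%:R + 1) ^+ 2 = eta * j%:R ^+ 2 + 2 * (eta * j%:R) + eta.
    by ring.
  lra.
have [_ dJ] := grow J (leqnn J).
have lt := big (2 * J)%N (leqnn _).
have sa : (s (2 * J)%N)%:R <= k%:R :> R by rewrite ler_nat ltnW // sk.
have sb : (s (2 * J).+1)%:R <= k%:R :> R by rewrite ler_nat ltnW // sk.
have k0 : 0 <= k%:R :> R by apply: ler0n.
have J0 : 0 <= J%:R :> R by apply: ler0n.
have sab : (s (2 * J)%N)%:R * (s (2 * J).+1)%:R <= k%:R * k%:R :> R.
  by apply: ler_pM.
set D := (d _)%:R in dJ lt.
have : (2 * k%:R) ^+ 2 <= (eta * J%:R) ^+ 2 :> R.
  by rewrite ler_pXn2r ?nnegrE //; nra.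
have : eta * (eta * J%:R ^+ 2) <= eta * (4 * D) by rewrite ler_pM2l.
nra.
Qed.

End LayerGrowth.

(** * Truncated breadth-first search and clean vertices *)

Section Exploration.
Variables (N k L cap : nat) (x : input N).
Implicit Types (S P Q Lv : {set 'I_N}) (X : {set {set 'I_N}}).
Local Notation G := (igraph x).
Local Notation nb := (nbrs x).

(** Reading [k] entries per list suffices, since a vertex with [k] neighbours already carries a
    star. *)
Definition read_edges S : {set {set 'I_N}} :=
  \bigcup_(v in S) [set [set v; w] | w in take k (nb v)].

Definition reach S := S :|: cover (read_edges S).

(** The search stops once the next set would exceed [cap], which bounds the queries. Around a clean
    vertex this never happens, see [clean_ball]. *)
Fixpoint explored n S :=
  if n is n'.+1 then
    if #|reach S| <= cap then explored n' (reach S) else read_edges S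
  else read_edges S.

Definition found (E : {set {set 'I_N}}) (F : graph 'I_N) :=
  [/\ eset F \subset E,
      (exists2 F', clos_refl_trans _ edge_contraction F F' &
         isomorphic F' (star k)) &
      (gsize F <= 2 * (cap + k))%N].

Definition clean v := ~ exists F, found (explored L [set v]) F.

Lemma read_edgesP S e :
  reflect (exists u w, [/\ u \in S, w \in take k (nb u) & e = [set u; w]])
          (e \in read_edges S).
Proof.
apply: (iffP bigcupP) => [[u Su /imsetP[w uw ->]]|[u [w [Su uw ->]]]].
  by exists u, w.
by exists u => //; apply: imset_f.
Qed.

Lemma read_edges_sub S : read_edges S \subset eset G.
Proof.
apply/subsetP=> _ /read_edgesP[u [w [_ /mem_take uw ->]]].
by rewrite -mem_nbrs.
Qed.

Lemma read_edgesS S S' : S \subset S' -> read_edges S \subset read_edges S'.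
Proof.
move=> /subsetP sS; apply/subsetP=> _ /read_edgesP[u [w [/sS Su uw ->]]].
by apply/read_edgesP; exists u, w.
Qed.

Lemma sub_reach S : S \subset reach S. Proof. exact: subsetUl. Qed.

Lemma reachP S w : w \in reach S ->
  w \in S \/ exists2 u, u \in S & [set u; w] \in read_edges S.
Proof.
rewrite inE => /orP[|/bigcupP[e /[dup] eE /read_edgesP[u [z [Su uz eq_e]]]]].
  by left.
rewrite eq_e => /set2P[->|->]; first by left.
by right; exists u => //; rewrite -eq_e.
Qed.

Lemma reach_nbr S u w : u \in S -> w \in take k (nb u) -> w \in reach S.
Proof.
move=> Su uw; rewrite inE; apply/orP; right; apply/bigcupP.
exists [set u; w]; last by rewrite !inE eqxx orbT.
by apply/read_edgesP; exists u, w.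
Qed.

Lemma explored_sub n S : explored n S \subset eset G.
Proof.
elim: n S => [|n IH] S /=; first exact: read_edges_sub.
by case: ifP => _; [apply: IH|apply: read_edges_sub].
Qed.

Lemma sub_explored n S : read_edges S \subset explored n S.
Proof.
elim: n S => [|n IH] S //=; case: ifP => // _.
exact: subset_trans (read_edgesS (sub_reach S)) (IH _).
Qed.

Lemma read_edges_explored n S j : j <= n ->
  (forall i, i <= j -> #|iter i reach S| <= cap) ->
  read_edges (iter j reach S) \subset explored n S.
Proof.
elim: n S j => [|n IH] S [|j] // jn capj; try exact: sub_explored.
rewrite /= (capj 1) // -iterS iterSr; apply: IH => // i ij.
by rewrite -iterSr capj.
Qed.

Hypothesis L_gt0 : 0 < L.
Hypothesis k_gt1 : 1 < k.
(** A ball of radius [L] that gains fewer than [k] vertices per layer has at most [1 + k * L]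
    vertices. *)
Hypothesis cap_ge : 1 + k * L <= cap.

Lemma clean_star_model v S Lv : clean v -> #|S| <= cap ->
  ~ star_model k (explored L [set v]) S Lv.
Proof.
move=> cl cS /star_model_contracts[F [sF cF gF]]; apply: cl; exists F; split=> //.
by apply: leq_trans gF _; rewrite leq_mul2l leq_add2r cS.
Qed.

Section CleanVertex.
Variables (v : 'I_N) (cl_v : clean v).
Local Notation K := (explored L [set v]).
Local Notation B j := (iter j reach [set v]).

(** As long as the balls stay below [cap], their edges belong to [K]; then [k] new vertices in the
    next layer would be leaves on a connected ball, a small star model that cleanness excludes. *)
Lemma clean_ball_card j : j <= L ->
  forall i, i <= j -> #|B i| <= 1 + k * i /\ connects K (B i).
Proof.
elim: j => [_ [|//] _|j IH jL i].
  by rewrite /= cards1; split; [|apply: connects1].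
rewrite leq_eqVlt ltnS => /orP[/eqP->|]; last exact: IH (ltnW jL) i.
have {}IH := IH (ltnW jL).
have [cB coB] := IH j (leqnn j).
have KB : read_edges (B j) \subset K.
  apply: read_edges_explored (ltnW jL) _ => i' ij.
  by have [c _] := IH i' ij; apply: leq_trans c _; apply: leq_trans cap_ge; nia.
have adj l : l \in reach (B j) ->
    l \in B j \/ exists2 u, u \in B j & [set u; l] \in K.
  by move=> /reachP[|[u Bu uE]]; [left|right; exists u; rewrite ?(subsetP KB)].
have eqB : B j.+1 = B j :|: (B j.+1 :\: B j).
  apply/setP=> z; rewrite in_setU in_setD.
  by have := subsetP (sub_reach (B j)) z; case: (z \in B j) => // ->.
split; last first.
  by rewrite /= -{1}(setUidPr (sub_reach (B j))); apply: connectsU => // l /adj.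
have : #|B j.+1 :\: B j| < k.
  rewrite ltnNge; apply/negP => kL.
  apply: (clean_star_model cl_v (S := B j) (Lv := B j.+1 :\: B j)).
    by apply: leq_trans cB _; apply: leq_trans cap_ge; nia.
  split=> //; first by rewrite disjoint_sym disjoints_subset setDE subsetIr.
  by move=> l; rewrite in_setD => /andP[lB /adj[|//]]; rewrite (negPf lB).
move=> lt; rewrite eqB; apply: leq_trans (leq_card_setU _ _).1 _; lia.
Qed.

Lemma clean_ball j : j <= L -> #|B j| <= cap /\ read_edges (B j) \subset K.
Proof.
move=> jL; have cB i : i <= j -> #|B i| <= cap.
  move=> ij; have [c _] := clean_ball_card jL ij.
  by apply: leq_trans c _; apply: leq_trans cap_ge; nia.
by split; [apply: cB|apply: read_edges_explored].
Qed.

(** The first [k] neighbours of [u] would form a star by themselves. Hence lists inside the ball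
    have been read to their end. *)
Lemma clean_ball_degree j u : j <= L -> u \in B j -> size (nb u) < k.
Proof.
move=> jL Bu; rewrite ltnNge; apply/negP => ku.
have [_ KB] := clean_ball jL.
apply: (clean_star_model cl_v (S := [set u]) (Lv := [set w in take k (nb u)])).
  by rewrite cards1; apply: leq_trans cap_ge.
split; first exact: connects1.
- rewrite disjoints1 inE; apply/negP => /mem_take.
  by rewrite mem_nbrs => /pair_edge[_ _]; rewrite eqxx.
- rewrite cardsE; have /card_uniqP-> : uniq (take k (nb u)).
    exact/take_uniq/nbrs_uniq.
  by rewrite size_takel.
move=> w; rewrite inE => uw; exists u; rewrite ?inE //.
by apply: (subsetP KB); apply/read_edgesP; exists u, w.
Qed.

Lemma clean_ball_edge j u w :
  j <= L -> u \in B j -> [set u; w] \in eset G ->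
  [set u; w] \in K /\ w \in reach (B j).
Proof.
move=> jL Bu; rewrite -mem_nbrs => uw.
have uw' : w \in take k (nb u) by rewrite take_oversize // ltnW // (clean_ball_degree jL).
have [_ KB] := clean_ball jL; split; last exact: reach_nbr uw'.
by apply: (subsetP KB); apply/read_edgesP; exists u, w.
Qed.

(** All edges at ball vertices have been read, so a star model of the whole graph with its tree in
    the ball is one in [K]. Its leaves may lie outside the ball. *)
Lemma clean_ball_free j S Lv : j <= L -> S \subset B j ->
  ~ star_model k (eset G) S Lv.
Proof.
move=> jL sS [[E tE sE] dS kL adj]; have [cB KB] := clean_ball jL.
apply: (clean_star_model cl_v (S := S) (Lv := Lv)).
  exact: leq_trans (subset_leq_card sS) cB.
split=> //.
  exists E => //; apply/subsetP=> e eE.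
  have /andP[/subsetP eS /cards2P[p [q [_ eq_e]]]] := tree_edge tE eE.
  have Sp : p \in S by apply: eS; rewrite eq_e !inE eqxx.
  rewrite eq_e; have [] // := @clean_ball_edge j p q jL (subsetP sS _ Sp).
  by rewrite -eq_e (subsetP sE).
move=> l /adj[u Su uE]; exists u => //.
by have [] := clean_ball_edge jL (subsetP sS _ Su) uE.
Qed.

Definition cut P Q : {set {set 'I_N}} :=
  [set e in eset G | [exists u in P, exists w in Q :\: P, e == [set u; w]]].

Lemma cutP P Q u w : [set u; w] \in eset G -> u \in P -> w \in Q -> w \notin P ->
  [set u; w] \in cut P Q.
Proof.
move=> uw Pu Qw Pw; rewrite inE uw; apply/exists_inP; exists u => //.
by apply/exists_inP; exists w; rewrite // inE Pw.
Qed.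

(** * Balls inside an induced subgraph *)

Section Layers.
Variables (Q : {set 'I_N}) (Qv : v \in Q).

(** [grown i.+1] is the ball of radius [i] around [v] in the subgraph induced by [Q]. Starting from
    the empty set makes [shell 0] equal to [[set v]]. *)
Fixpoint grown i : {set 'I_N} :=
  if i is i'.+1 then
    v |: (grown i' :|: [set w in Q | [exists u in grown i', w \in nb u]])
  else set0.

Lemma grownS i : grown i \subset grown i.+1.
Proof. by apply/subsetP=> w /= w_i; rewrite !inE w_i orbT. Qed.

Lemma grown_sub i : grown i \subset Q.
Proof.
elim: i => [|i IH] /=; first exact: sub0set.
rewrite !subUset sub1set Qv IH; apply/subsetP=> w.
by rewrite inE => /andP[].
Qed.

Lemma grown_ball i : i <= L -> grown i.+1 \subset B i.
Proof.
elim: i => [|i IH] iL.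
  rewrite /= !subUset subxx sub0set; apply/subsetP=> w.
  by rewrite !inE => /andP[_ /exists_inP[u]]; rewrite inE.
have {}IH := IH (ltnW iL).
rewrite [grown i.+2]/= -[v |: (grown i :|: _)]/(grown i.+1) 2!subUset.
apply/and3P; split.
- by rewrite sub1set (subsetP (sub_reach _)) // (subsetP IH) //= !inE eqxx.
- exact: subset_trans IH (sub_reach _).
apply/subsetP=> w; rewrite inE => /andP[_ /exists_inP[u uD]]; rewrite mem_nbrs => uw.
by have [] := clean_ball_edge (ltnW iL) (subsetP IH _ uD) uw.
Qed.

Lemma grown_nbr i u w : u \in grown i -> [set u; w] \in eset G -> w \in Q ->
  w \in grown i.+1.
Proof.
move=> uD uw Qw /=; rewrite !inE Qw /=; apply/orP; right; apply/orP; right.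
by apply/exists_inP; exists u; rewrite // mem_nbrs.
Qed.

Lemma grown_adj i w : w \in grown i.+2 :\: grown i.+1 ->
  exists2 u, u \in grown i.+1 & [set u; w] \in eset G.
Proof.
rewrite in_setD => /andP[wD]; rewrite [grown i.+2]/= -[v |: (grown i :|: _)]/(grown i.+1).
rewrite in_setU1 in_setU (negPf wD) inE => /orP[/eqP wv|/andP[_ /exists_inP[u uD]]].
  by rewrite wv /= !inE eqxx in wD.
by rewrite mem_nbrs; exists u.
Qed.

Lemma grown_connects i : connects (eset G) (grown i.+1).
Proof.
elim: i => [|i IH].
  rewrite (_ : grown 1 = [set v]); first exact: connects1.
  apply/setP=> w; rewrite /= !inE; case: (w =P v) => //= _.
  by apply/negP => /andP[_ /exists_inP[u]]; rewrite inE.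
rewrite -(setUidPr (grownS i.+1)); apply: connectsU => // w wD.
case: (boolP (w \in grown i.+1)) => wD'; [by left|right].
by apply: grown_adj; rewrite in_setD wD' wD.
Qed.

Definition shell i := grown i.+1 :\: grown i.

Lemma card_grown i : #|grown i.+1| = (#|grown i| + #|shell i|)%N.
Proof.
by rewrite -(cardsID (grown i) (grown i.+1)) (setIidPr (grownS i)).
Qed.

(** Beyond [shell 0], a shell consists of neighbours of the connected set [grown] before it, so [k]
    of them would complete a star. That tree lies in a ball of radius one less than the index,
    whence the range up to [L.+1]. *)
Lemma card_shell i : i <= L.+1 -> #|shell i| < k.
Proof.
case: i => [_|i iL].
  apply: leq_ltn_trans k_gt1; rewrite -(cards1 v); apply: subset_leq_card.
  apply: subset_trans (subsetDl _ _) _; exact: grown_ball.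
rewrite ltnNge; apply/negP => kS.
apply: (clean_ball_free (S := grown i.+1) (Lv := shell i.+1) iL (grown_ball iL)).
split=> //; first exact: grown_connects.
  by rewrite disjoint_sym disjoints_subset /shell setDE subsetIr.
exact: grown_adj.
Qed.

(** An edge leaving [grown i.+1] inside [Q] starts in the last shell, for otherwise its far end
    would have been added already, and it ends in the next shell. *)
Lemma card_cut i : #|cut (grown i.+1) Q| <= #|shell i| * #|shell i.+1|.
Proof.
rewrite -cardsX; apply: leq_trans (leq_imset_card (fun p => [set p.1; p.2]) _).
apply/subset_leq_card/subsetP=> e; rewrite inE => /andP[eG /exists_inP[u uD]].
move=> /exists_inP[w]; rewrite in_setD => /andP[wD Qw] /eqP eq_e.
rewrite eq_e in eG *; apply/imsetP; exists (u, w) => //.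
rewrite in_setX /shell !in_setD /= -/(grown i) uD wD (grown_nbr uD eG Qw) !andbT.
by apply: contra wD => uD'; apply: grown_nbr eG Qw.
Qed.

End Layers.

Variables (R : realType) (eta : R) (J : nat).
Hypotheses (eta_gt0 : (0 < eta)%R) (eta_le1 : (eta <= 1)%R).
Hypotheses (kJ : (2 * k%:R <= eta * J%:R)%R) (LJ : L = 2 * J).

Lemma clean_piece (Q : {set 'I_N}) : v \in Q -> exists P : {set 'I_N},
  [/\ v \in P, P \subset Q, (#|cut P Q|%:R <= eta * #|P|%:R)%R &
      forall S Lv, S \subset P -> ~ star_model k (eset G) S Lv].
Proof.
move=> Qv.
have [|||i iJ le_i] := @layer_growth R eta k J (fun i => #|grown Q i|)
    (fun i => #|shell Q i|) eta_gt0 eta_le1 kJ.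
- by apply/card_gt0P; exists v; rewrite /= !inE eqxx.
- exact: card_grown.
- by move=> i iJ; apply: card_shell; rewrite // LJ.
rewrite -LJ in iJ.
exists (grown Q i.+1); split.
- by rewrite /= !inE eqxx.
- exact: grown_sub.
- by apply: le_trans le_i; rewrite ler_nat card_cut.
by move=> S Lv sS; apply: clean_ball_free iJ (subset_trans sS (grown_ball _ iJ)).
Qed.

End CleanVertex.

(** * Removing few edges to destroy all stars *)

Section Decomposition.
Variables (R : realType) (eta : R) (J : nat).
Hypotheses (eta_gt0 : (0 < eta)%R) (eta_le1 : (eta <= 1)%R).
Hypotheses (kJ : (2 * k%:R <= eta * J%:R)%R) (LJ : L = 2 * J).

(** Cleanness refers to the whole graph, so it persists in [Q :\: P]. Pieces [P] are split off one
    by one, each cut being charged to [eta * #|P|]; a tree that avoids the cut lies inside [P] or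
    entirely outside it. *)
Lemma clean_decomposition (Q : {set 'I_N}) : {in Q, forall v, clean v} ->
  exists X, [/\ X \subset eset G, (#|X|%:R <= eta * #|Q|%:R)%R &
    forall S Lv, S \subset Q -> Lv \subset Q ->
      ~ star_model k (eset G :\: X) S Lv].
Proof.
elim: {Q}_.+1 {-2}Q (ltnSn #|Q|) => // n IH Q Qn clQ.
have [->|[v Qv]] := set_0Vmem Q.
  exists set0; rewrite sub0set !cards0 mulr0; split=> // S Lv.
  rewrite subset0 => /eqP-> _ [[E tE _]] _ _ _.
  by have := tree_neq0 tE; rewrite eqxx.
have [P [Pv sPQ cutP' freeP]] := clean_piece (clQ v Qv) eta_gt0 eta_le1 kJ LJ Qv.
have [||X [sX cX freeX]] := IH (Q :\: P).
- rewrite -ltnS; apply: leq_trans Qn; rewrite ltnS; apply: proper_card.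
  by apply/properP; split; [apply: subsetDl|exists v; rewrite // inE Pv].
- by move=> u; rewrite inE => /andP[_]; apply: clQ.
exists (X :|: cut P Q); split.
- by rewrite subUset sX; apply/subsetP=> e; rewrite inE => /andP[].
- have -> : #|Q| = (#|P| + #|Q :\: P|)%N.
    by rewrite -(cardsID P Q) (setIidPr sPQ).
  rewrite natrD mulrDr addrC; apply: le_trans (lerD cX cutP').
  by rewrite -natrD ler_nat (leq_card_setU _ _).1.
move=> S Lv sS sL mS; have [cS dS kL adj] := mS.
have outP u w : u \in Q -> w \in Q ->
    [set u; w] \in eset G :\: (X :|: cut P Q) -> (u \in P) -> (w \in P).
  move=> Qu Qw; rewrite !in_setD in_setU negb_or => /andP[/andP[_ nc] uw] Pu.
  by apply: contraNT nc => Pw; apply: cutP.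
have sGX : eset G :\: (X :|: cut P Q) \subset eset G by apply: subsetDl.
have [|SP|SP] := connects_closed (P := P) _ cS.
- move=> u w /(subsetP sS) Qu /(subsetP sS) Qw uw; apply/idP/idP.
    exact: outP uw.
  by apply: outP; rewrite // setUC.
- exact: freeP SP (star_modelS sGX mS).
have notP z : z \in S -> z \notin P by move=> Sz; rewrite (disjointFr SP Sz).
apply: (freeX S Lv).
- by apply/subsetP=> z Sz; rewrite inE notP // (subsetP sS).
- apply/subsetP=> l Ll; rewrite inE (subsetP sL) // andbT.
  have [u Su ul] := adj l Ll; apply: contra (notP u Su); apply: outP.
  + exact: (subsetP sL).
  + exact: (subsetP sS).
  by rewrite setUC.
by apply: star_modelS mS; rewrite -setDDl subsetDl.
Qed.

Lemma few_dirty_close (W : {set 'I_N}) : (forall v, v \notin W -> clean v) ->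
  exists X, [/\ X \subset eset G, star_minor_free k (remove_edges G X) &
    (#|X|%:R <= k%:R * #|W|%:R + #|W|%:R ^+ 2 + eta * N%:R)%R].
Proof.
move=> clW.
have [|X [sX cX freeX]] := @clean_decomposition (~: W).
  by move=> v; rewrite inE; apply: clW.
pose X1 := [set e in eset G | ~~ [disjoint W & e]].
(* An edge from [u] in [W] to a clean [w] puts [u] in the ball around [w], so [u] has degree below
   [k] and the edge is among the first [k] entries of its list. The other edges at [W] join two
   vertices of [W]. *)
have sX1 : X1 \subset read_edges W :|: [set [set p.1; p.2] | p in setX W W].
  apply/subsetP=> e; rewrite inE => /andP[eG /pred0Pn[u /andP[/= Wu eu]]].
  have /andP[_ /cards2P[p [q [pq eq_e]]]] := esetP eG.
  have [w eq_e'] : exists w, e = [set u; w].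
    move: eu; rewrite eq_e => /set2P[->|->]; first by exists q.
    by exists p; rewrite setUC.
  rewrite {}eq_e' {p q pq eq_e} in eG *; rewrite inE.
  case: (boolP (w \in W)) => Ww; apply/orP.
    by right; apply/imsetP; exists (u, w); rewrite // inE Wu.
  left; apply/read_edgesP; exists u, w; split=> //.
  have wu : [set w; u] \in eset G by rewrite setUC.
  have [_ Bu] := @clean_ball_edge w (clW w Ww) 0 w u (leq0n _) (set11 w) wu.
  rewrite take_oversize ?mem_nbrs // ltnW //.
  exact: (@clean_ball_degree w (clW w Ww) 1 u L_gt0 Bu).
have cR : #|read_edges W| <= k * #|W|.
  rewrite mulnC; apply: card_bigcup_leq => v.
  apply: leq_trans (leq_imset_card _ _) _; apply: leq_trans (card_size _) _.
  by rewrite size_take; case: ltnP.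
exists (X :|: X1); split.
- by rewrite subUset sX; apply/subsetP=> e; rewrite inE => /andP[].
- move=> /(has_minor_star_model (ltnW k_gt1))[S [Lv mS]].
  have [cS dS kL adj] := mS.
  have outW u w : [set u; w] \in eset (remove_edges G (X :|: X1)) ->
      u \notin W /\ w \notin W.
    rewrite /= in_setD in_setU negb_or inE => /andP[/andP[_]] + uw.
    rewrite uw negbK disjoint_sym disjoint_setU1 disjoints1 => /andP[].
    by split.
  have sL : Lv \subset ~: W by apply/subsetP=> l /adj[u _ /outW[_]]; rewrite inE.
  have sS : S \subset ~: W.
    have /card_gt0P[l /adj[u Su /outW[Wu _]]] := leq_trans (ltnW k_gt1) kL.
    have [|SW|] := connects_closed (P := W) _ cS; last by rewrite disjoints_subset.
      by move=> y z _ _ /outW[/negPf-> /negPf->].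
    by rewrite (subsetP SW) in Wu.
  apply: (freeX S Lv sS sL); apply: star_modelS mS.
  by rewrite /= -setDDl subsetDl.
rewrite -natrM -natrX -natrD.
have le1 : (#|X :|: X1|%:R <= (#|X|)%:R + (k * #|W| + #|W| ^ 2)%:R :> R)%R.
  rewrite -natrD ler_nat; apply: leq_trans (leq_card_setU _ _).1 _.
  rewrite leq_add2l; apply: leq_trans (subset_leq_card sX1) _.
  apply: leq_trans (leq_card_setU _ _).1 (leq_add cR _).
  by apply: leq_trans (leq_imset_card _ _) _; rewrite cardsX mulnn.
have le2 : (eta * #|~: W|%:R <= eta * N%:R)%R.
  by rewrite ler_pM2l // ler_nat -[X in _ <= X]card_ord max_card.
lra.
Qed.

End Decomposition.
End Exploration.

(** * The search algorithm *)

Section QueryMonad.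
Variable N : nat.

Fixpoint bind A B (t : dalg N A) (f : A -> dalg N B) : dalg N B :=
  match t with
  | Output a => f a
  | Ask q next => Ask (fun r => bind (next r) f)
  end.

Lemma eval_bind A B (t : dalg N A) (f : A -> dalg N B) x :
  eval (bind t f) x = eval (f (eval t x)) x.
Proof. by elim: t => //= q next IH; apply: IH. Qed.

Lemma nqueries_bind A B (t : dalg N A) (f : A -> dalg N B) x :
  nqueries (bind t f) x = (nqueries t x + nqueries (f (eval t x)) x)%N.
Proof. by elim: t => //= q next IH; rewrite IH addSn. Qed.

Fixpoint bind_map A B (f : A -> dalg N B) (s : seq A) : dalg N (seq B) :=
  if s is a :: s' then
    bind (f a) (fun b => bind (bind_map f s') (fun bs => Output N (b :: bs)))
  else Output N [::].

Lemma eval_bind_map A B (f : A -> dalg N B) s x :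
  eval (bind_map f s) x = [seq eval (f a) x | a <- s].
Proof. by elim: s => //= a s IH; rewrite !eval_bind /= IH. Qed.

Lemma nqueries_bind_map A B (f : A -> dalg N B) (s : seq A) (C : nat) x :
  (forall a, nqueries (f a) x <= C) -> nqueries (bind_map f s) x <= size s * C.
Proof.
move=> fC; elim: s => //= a s IH; rewrite !nqueries_bind /= addn0 mulSn.
exact: leq_add.
Qed.

End QueryMonad.

Lemma pmap_onth T (s : seq T) n : pmap id [seq onth s i | i <- iota 0 n] = take n s.
Proof.
elim: n s => [|n IH] s; first by rewrite take0.
case: s => [|a s] /=.
  by rewrite -[1]addn0 iotaDl -map_comp; elim: (iota 0 n).
by rewrite -[1]addn0 iotaDl -map_comp -IH.
Qed.

Section Algorithm.
Variables (N k L cap t : nat).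
Implicit Types (S : {set 'I_N}) (x : input N).

Definition ask v (i : 'I_N.-1) : dalg N (option 'I_N) :=
  Ask (fun r : answer (Nbr v i) => Output N r).

(** Indices range over ['I_N.-1], so for [k] above [N.-1] only [N.-1] queries are made; by
    [size_nbrs] nothing is lost. *)
Definition ask_nbrs v : dalg N {set {set 'I_N}} :=
  bind (bind_map (ask v) [seq i : 'I_N.-1 <- enum 'I_N.-1 | i < k])
    (fun s => Output N [set [set v; w] | w in pmap id s]).

Definition ask_edges S : dalg N {set {set 'I_N}} :=
  bind (bind_map ask_nbrs (enum S)) (fun Es => Output N (\bigcup_(E <- Es) E)).

Fixpoint explore n S : dalg N {set {set 'I_N}} :=
  bind (ask_edges S) (fun E =>
    if n is n'.+1 then
      if #|S :|: cover E| <= cap then explore n' (S :|: cover E) else Output N E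
    else Output N E).

(** The minor is picked by classical choice: this asks no queries, and only queries are counted. *)
Definition find_minor (E : {set {set 'I_N}}) : option (graph 'I_N) :=
  if pselect (exists F, found k cap E F) is left h then Some (sval (cid h))
  else None.

Definition sample_run (w : {ffun 'I_t -> 'I_N}) : dalg N (option (graph 'I_N)) :=
  bind (bind_map (fun i => explore L [set w i]) (enum 'I_t))
    (fun Es => Output N (ohead (pmap find_minor Es))).

Lemma size_nbrs x v : size (nbrs x v) <= N.-1.
Proof.
have N0 : 0 < N by apply: leq_ltn_trans (ltn_ord v).
rewrite -ltnS prednK // -[X in _ < X]card_ord.
have /card_uniqP <- := nbrs_uniq x v.
apply: (@leq_trans #|[set~ v]|.+1); last by rewrite cardsC1 prednK // card_ord.
rewrite ltnS; apply/subset_leq_card/subsetP=> w; rewrite mem_nbrs => /pair_edge[_ _].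
by rewrite !inE eq_sym.
Qed.

Lemma low_indices :
  [seq val i | i : 'I_N.-1 <- enum 'I_N.-1 & i < k] = iota 0 (minn k N.-1).
Proof.
rewrite -(filter_map val (fun i => i < k)) val_enum_ord.
elim: N.-1 => [|n IH]; first by rewrite minn0.
rewrite -{1}addn1 iotaD filter_cat IH /= add0n; case: ltnP => kn.
  by rewrite !(minn_idPr _) ?(ltnW kn) // -[in RHS]addn1 iotaD.
by rewrite cats0 !(minn_idPl _) // (leq_trans kn).
Qed.

Lemma eval_ask_nbrs v x :
  eval (ask_nbrs v) x = [set [set v; w] | w in take k (nbrs x v)].
Proof.
rewrite /ask_nbrs eval_bind eval_bind_map /=.
have -> : [seq onth (nbrs x v) i | i : 'I_N.-1 <- enum 'I_N.-1 & i < k] =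
          [seq onth (nbrs x v) i | i <- iota 0 (minn k N.-1)].
  by rewrite -low_indices -map_comp.
rewrite pmap_onth; have := size_nbrs x v.
case: (leqP k N.-1) => [//|kN sz].
by rewrite !take_oversize // (leq_trans sz) // ltnW.
Qed.

Lemma nqueries_ask_nbrs v x : nqueries (ask_nbrs v) x <= k.
Proof.
rewrite /ask_nbrs nqueries_bind /= addn0.
apply: leq_trans (nqueries_bind_map (C := 1) _ _) _; first by [].
rewrite muln1 -(size_map val) low_indices size_iota; exact: geq_minl.
Qed.

Lemma eval_ask_edges S x : eval (ask_edges S) x = read_edges k x S.
Proof.
rewrite /ask_edges eval_bind eval_bind_map /= big_map big_enum.
by apply: eq_bigr => v _; rewrite eval_ask_nbrs.
Qed.

Lemma nqueries_ask_edges S x : nqueries (ask_edges S) x <= #|S| * k.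
Proof.
rewrite /ask_edges nqueries_bind /= addn0 cardE.
by apply: nqueries_bind_map => v; apply: nqueries_ask_nbrs.
Qed.

Lemma eval_explore n S x : eval (explore n S) x = explored k cap x n S.
Proof.
elim: n S => [|n IH] S; rewrite [explore _ _]/= eval_bind eval_ask_edges //=.
by rewrite -/(reach k x S); case: ifP => // _; apply: IH.
Qed.

Lemma nqueries_explore n S x :
  #|S| <= cap -> nqueries (explore n S) x <= n.+1 * (cap * k).
Proof.
elim: n S => [|n IH] S cS; rewrite [explore _ _]/= nqueries_bind eval_ask_edges mulSn.
all: apply: leq_add;
  first by apply: leq_trans (nqueries_ask_edges _ _) _; rewrite leq_mul2r cS orbT.
  by [].
by case: ifP => // cR; apply: IH.
Qed.

Lemma find_minorP E F : find_minor E = Some F -> found k cap E F.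
Proof. by rewrite /find_minor; case: pselect => // h [<-]; case: cid. Qed.

Lemma find_minor_accepts E : accepts (find_minor E) <-> ~ exists F, found k cap E F.
Proof. by rewrite /find_minor; case: pselect. Qed.

Lemma eval_sample_run w x : eval (sample_run w) x =
  ohead (pmap find_minor [seq explored k cap x L [set w i] | i <- enum 'I_t]).
Proof.
rewrite /sample_run eval_bind eval_bind_map /=; congr (ohead (pmap _ _)).
by apply: eq_map => i; rewrite eval_explore.
Qed.

Lemma sample_run_Some w x F : eval (sample_run w) x = Some F ->
  exists i, found k cap (explored k cap x L [set w i]) F.
Proof.
rewrite eval_sample_run; elim: (enum _) => //= i s IH.
case fE: (find_minor _) => [F'|] //= [eqF].
by exists i; apply: find_minorP; rewrite fE eqF.
Qed.

Lemma sample_run_accepts w x :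
  accepts (eval (sample_run w) x) =
  [forall i, accepts (find_minor (explored k cap x L [set w i]))].
Proof.
rewrite eval_sample_run.
transitivity (all (fun i => accepts (find_minor (explored k cap x L [set w i])))
                  (enum 'I_t)).
  by elim: (enum _) => //= i s IH; case: find_minor.
apply/allP/forallP => [h i|h i _] //; exact: h (mem_enum _ _).
Qed.

Lemma nqueries_sample_run w x : 0 < cap ->
  nqueries (sample_run w) x <= t * (L.+1 * (cap * k)).
Proof.
move=> cap0; rewrite /sample_run nqueries_bind /= addn0.
rewrite -[X in _ <= X * _](size_enum_ord t).
by apply: nqueries_bind_map => i; apply: nqueries_explore; rewrite cards1.
Qed.

End Algorithm.

(** * The tester *)

Local Open Scope ring_scope.

Lemma nat_approx (R : realType) (y : R) : 0 <= y ->
  exists n : nat, y <= n%:R <= y + 1.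
Proof.
move=> y0; exists (Num.truncn y).+1; have /andP[h1 h2] := Num.Theory.truncn_itv y0.
by rewrite (ltW h2) -natr1 lerD2r.
Qed.

(** A division-free form of [(1 - p) ^ n <= 1 / (1 + n * p)], which is at most [1 / 3] once
    [n * p >= 2]. In the induction, [(1 - p) * (1 + (n + 1) * p)] is [1 + n * p] minus a square
    term. *)
Lemma exprB1_le (R : realType) (p : R) n : 0 <= p <= 1 ->
  (1 - p) ^+ n * (1 + n%:R * p) <= 1.
Proof.
move=> /andP[p0 p1]; elim: n => [|n IH]; first by rewrite expr0 mul0r addr0 mulr1.
apply: le_trans IH; rewrite exprS [(1 - p) * _]mulrC -mulrA.
apply: ler_wpM2l; first by rewrite exprn_ge0 // subr_ge0.
rewrite -natr1; have n0 : 0 <= n%:R :> R by apply: ler0n.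
have : 0 <= p ^+ 2 * (n%:R + 1) by rewrite mulr_ge0 ?sqr_ge0 // addr_ge0.
lra.
Qed.

Section SampleTester.
Variables (R : realType) (N k L cap t : nat).
Hypothesis N_gt0 : (0 < N)%N.

Let sample_prob (w : {ffun 'I_t -> 'I_N}) : R := (N%:R ^+ t)^-1.

Lemma sample_prob_ge0 w : 0 <= sample_prob w.
Proof. by rewrite invr_ge0 exprn_ge0 // ler0n. Qed.

Lemma sample_prob_sum (A : pred 'I_N) :
  \sum_(w : {ffun 'I_t -> 'I_N} | [forall i, A (w i)]) sample_prob w =
  (#|A|%:R / N%:R) ^+ t.
Proof.
rewrite sumr_const expr_div_n -[LHS]mulr_natl; congr (_ * _); rewrite -natrX; congr _%:R.
rewrite -[t in RHS]card_ord -card_ffun_on.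
by apply: eq_card => w; rewrite !inE.
Qed.

Lemma sample_prob_sum1 : \sum_w sample_prob w = 1.
Proof.
have := sample_prob_sum predT; rewrite card_ord divff ?pnatr_eq0 -?lt0n //.
rewrite expr1n => <-; apply: eq_bigl => w; apply/esym/forallP => //.
Qed.

Definition sample_tester : ralg R N (option (graph 'I_N)) :=
  RAlg sample_prob_ge0 sample_prob_sum1 (@sample_run N k L cap t).

Definition dirty (x : input N) : {set 'I_N} :=
  [set v | ~~ accepts (find_minor k cap (explored k cap x L [set v]))].

(** Acceptance means that all [t] independent samples miss the dirty vertices. *)
Lemma sample_tester_accept x : accept_prob (@accepts (graph 'I_N)) sample_tester x =
  (1 - #|dirty x|%:R / N%:R) ^+ t.
Proof.
have eqA : #|~: dirty x|%:R / N%:R = 1 - #|dirty x|%:R / N%:R :> R.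
  have N0 : N%:R != 0 :> R by rewrite pnatr_eq0 -lt0n.
  have : #|dirty x|%:R + #|~: dirty x|%:R = N%:R :> R.
    by rewrite -natrD cardsC card_ord.
  by move=> /(canRL (addKr _)) ->; field.
rewrite -eqA -sample_prob_sum; apply: eq_bigl => w /=.
rewrite sample_run_accepts; apply: eq_forallb => i.
by rewrite -[RHS]/(w i \in ~: dirty x) !inE negbK.
Qed.

End SampleTester.

(** A rejecting seed of positive probability would exhibit a minor in a minor-free graph. *)
Lemma star_minor_rejection_one_sided (R : realType) N (c s : R) k
    (M : ralg R N (option (graph 'I_N))) :
  rejects_with_star_minor c k s M -> one_sided c k (@accepts (graph 'I_N)) M.
Proof.
move=> rej x adm free; rewrite /accept_prob -[RHS](prob_sum1 M).
rewrite [RHS](bigID (fun w => accepts (eval (run w) x))) /= [X in _ = _ + X]big1 ?addr0 //.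
move=> w; rewrite /accepts; case ev: (eval _ x) => [F|//] _.
have := prob_ge0 w; rewrite le_eqVlt => /orP[/eqP//|w0].
by have [/minor_of_has_minor/free] := rej x adm w w0 F ev.
Qed.

Lemma one_sided_tester (R : realType) N (c eps : R) k
    (M : ralg R N (option (graph 'I_N))) :
  one_sided c k (@accepts (graph 'I_N)) M ->
  (forall x, admissible c x -> far_from_star_minor_free k eps (igraph x) ->
     accept_prob (@accepts (graph 'I_N)) M x <= 1 / 3) ->
  star_minor_tester c k eps (@accepts (graph 'I_N)) M.
Proof.
move=> os far x adm; split; last exact: far.
by move=> /(os x adm)->; lra.
Qed.

Lemma edgeless_star_minor_free (T : finType) k (G : graph T) :
  (0 < k)%N -> eset G = set0 -> star_minor_free k G.
Proof.
move=> k0 eG /(has_minor_star_model k0)[S [L [_ _ kL adj]]].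
have /card_gt0P[l /adj[u _]] := leq_trans k0 kL.
by rewrite eG inE.
Qed.

(** Removing every edge leaves no star, so a far graph would satisfy [2 * eps * #|E| < #|E|]. *)
Lemma no_far_graph (R : realType) (T : finType) k (eps : R) (G : graph T) :
  (0 < k)%N -> 1 / 2 <= eps -> ~ far_from_star_minor_free k eps G.
Proof.
move=> k0 e2 /(_ (eset G) (subxx _)).
have free : star_minor_free k (remove_edges G (eset G)).
  by apply: edgeless_star_minor_free => //=; rewrite setDv.
move=> /(_ free).
have : 0 <= #|eset G|%:R :> R by apply: ler0n.
nra.
Qed.

Lemma constant_tester (R : realType) N A (a : A) :
  exists M : ralg R N A, forall w : seed M, run w = Output N a.
Proof.
have p0 : forall w : unit, 0 <= (fun=> 1 : R) w by [].
have p1 : \sum_(w : unit) (fun=> 1 : R) w = 1 by rewrite sumr_const card_unit.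
by exists (RAlg p0 p1 (fun=> Output N a)).
Qed.

(** * Choice of parameters for the tester *)

Section UpperBound.
Variables (R : realType) (c : R) (k N : nat) (eps : R).
Hypotheses (c_gt0 : 0 < c) (k_ge3 : (3 <= k)%N) (N_gt0 : (0 < N)%N).
Hypotheses (eps_gt0 : 0 < eps) (eps_lt : eps < 1 / 2).

(** Capping at 1 keeps [eta] at most 1, while [c1 <= c] gives [eta * N <= eps * #|E|] on admissible
    inputs. *)
Let c1 := Num.min c 1.
Let eta := eps * c1.

Let c1_gt0 : 0 < c1. Proof. by rewrite lt_min c_gt0 ltr01. Qed.
Let c1_le1 : c1 <= 1. Proof. by rewrite ge_min lexx orbT. Qed.
Let c1_lec : c1 <= c. Proof. by rewrite ge_min lexx. Qed.
Let eta_gt0 : 0 < eta. Proof. exact: mulr_gt0. Qed.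
Let eta_le1 : eta <= 1. Proof.
apply: mulr_ile1 => //; [exact: ltW|exact: ltW|].
by apply: ltW; apply: lt_trans eps_lt _; lra.
Qed.
Let k_ge3R : 3 <= k%:R :> R. Proof. by rewrite (ler_nat R 3). Qed.
Let N_ge1 : 1 <= N%:R :> R. Proof. by rewrite ler1n. Qed.
Let sqrtN_ge1 : 1 <= Num.sqrt N%:R :> R.
Proof. by rewrite -[X in X <= _]sqrtr1 ler_wsqrtr. Qed.
Let sqrtN2 : Num.sqrt N%:R * Num.sqrt N%:R = N%:R :> R.
Proof. by rewrite -expr2 sqr_sqrtr // ler0n. Qed.

(** Otherwise [few_dirty_close] removes at most [eta * N * (1/2 + 1/4 + 1)] edges, less than
    [2 * eta * N <= 2 * eps * #|E|], and the graph is not far. *)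
Lemma far_dirty (J : nat) (x : input N) : (0 < J)%N -> 2 * k%:R <= eta * J%:R ->
  admissible c x -> far_from_star_minor_free k eps (igraph x) ->
  eta * Num.sqrt N%:R < 2 * k%:R * #|dirty k (2 * J) (1 + k * (2 * J)) x|%:R.
Proof.
move=> J0 kJ adm far; rewrite ltNge; apply/negP => few.
set W := dirty _ _ _ x in few.
have L0 : (0 < 2 * J)%N by rewrite muln_gt0.
have k1 : (1 < k)%N by apply: leq_trans k_ge3.
have [v|X [sX free cX]] := few_dirty_close L0 k1 (leqnn _) eta_gt0 eta_le1 kJ
    erefl (W := W) (x := x).
  by rewrite inE negbK find_minor_accepts.
have {far} := far X sX free.
move: adm; rewrite /admissible => adm.
have r2 := sqrtN2; have r1 := sqrtN_ge1; have k3 := k_ge3R.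
set w := #|W|%:R in few cX; set r := Num.sqrt N%:R in few r1 r2.
set m := #|eset _|%:R in adm *.
have w0 : 0 <= w by apply: ler0n.
have r0 : 0 <= r by apply: le_trans r1.
have rN : r <= N%:R by rewrite -r2 ler_peMr.
have h1 : k%:R * w <= eta * N%:R / 2.
  by have : eta * r <= eta * N%:R by [rewrite ler_pM2l]; lra.
have h2 : w ^+ 2 <= eta * N%:R / 4.
  have w2 : w <= eta * r / 6.
    have : 6 * w <= 2 * k%:R * w by apply: ler_wpM2r => //; lra.
    lra.
  have : w ^+ 2 <= (eta * r / 6) ^+ 2.
    by apply: lerXn2r; rewrite ?nnegrE // divr_ge0 // mulr_ge0 // ltW.
  have -> : (eta * r / 6) ^+ 2 = eta * (eta * N%:R) / 36 by rewrite -r2; field.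
  have : eta * (eta * N%:R) <= eta * N%:R.
    by rewrite ger_pMl // mulr_gt0 // (lt_le_trans _ N_ge1).
  have : 0 <= eta * N%:R by rewrite mulr_ge0 // ltW // (lt_le_trans _ N_ge1).
  lra.
have h3 : 2 * (eta * N%:R) <= 2 * eps * m.
  rewrite -mulrA ler_pM2l // /eta -mulrA ler_pM2l //.
  by apply: le_trans adm; rewrite ler_pM2r // (lt_le_trans _ N_ge1).
have h4 : 0 < eta * N%:R by rewrite mulr_gt0 // (lt_le_trans _ N_ge1).
lra.
Qed.

Lemma small_eps_tester : exists M : ralg R N (option (graph 'I_N)),
  [/\ star_minor_tester c k eps (@accepts (graph 'I_N)) M,
      one_sided c k (@accepts (graph 'I_N)) M,
      makes_at_most c M (245 / c1 ^+ 3 * Num.sqrt N%:R * (k%:R / eps) ^+ 5) &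
      rejects_with_star_minor c k (245 / c1 ^+ 3 * (k%:R ^+ 2 / eps)) M].
Proof.
have k3 := k_ge3R; have e2 := eps_lt; have e0 := eps_gt0.
have ne_eps : eps != 0 by rewrite gt_eqF.
have ne_c1 : c1 != 0 by rewrite gt_eqF.
have ne_eta : eta != 0 by rewrite gt_eqF.
set r : R := Num.sqrt N%:R.
pose y : R := k%:R / eps; pose u : R := c1^-1.
have u1 : 1 <= u by rewrite invf_ge1.
have ky : k%:R <= y by rewrite ler_pdivlMr // ler_piMr ?ler0n //; lra.
have yu : k%:R / eta = y * u by rewrite /y /u /eta; field; rewrite ?ne_eps ?ne_c1.
have y1 : 1 <= y by lra.
have yu1 : 1 <= y * u by rewrite -[1]mulr1 ler_pM.
(* Since [y * u = k / eta], this depth meets the requirement [2 * k <= eta * J] of [layer_growth];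
   [t] is then chosen so that a far graph yields at least 2 dirty samples on average. *)
have [J /andP[J1 J2]] : exists n : nat, 2 * (y * u) <= n%:R <= 2 * (y * u) + 1.
  by apply: nat_approx; lra.
have [t /andP[t1 t2]] : exists n : nat, 4 * (y * u) * r <= n%:R <= 4 * (y * u) * r + 1.
  by apply: nat_approx; rewrite mulr_ge0 ?sqrtr_ge0 //; lra.
have J0 : (0 < J)%N by rewrite -(ltr0n R); lra.
have kJ : 2 * k%:R <= eta * J%:R.
  have -> : 2 * k%:R = eta * (2 * (y * u)) by rewrite -yu; field.
  by rewrite ler_pM2l.
pose cap := (1 + k * (2 * J))%N.
pose M := @sample_tester R N k (2 * J) cap t N_gt0.
have rej : rejects_with_star_minor c k (245 / c1 ^+ 3 * (k%:R ^+ 2 / eps)) M.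
  move=> x adm w _ F /sample_run_Some[i [sF cF gF]]; split.
    split=> //; apply/andP; split; first by rewrite igraph_full subsetT.
    by apply: subset_trans sF _; apply: explored_sub.
  apply: (@le_trans _ _ (2 * (cap + k))%:R); first by rewrite ler_nat.
  rewrite /cap natrM !natrD !natrM.
  have -> : k%:R ^+ 2 / eps = k%:R * y by rewrite /y; ring.
  have z1 : 1 <= k%:R * y * u by rewrite -mulrA -[1]mulr1 ler_pM //; lra.
  have kz : k%:R <= k%:R * y * u by rewrite -mulrA ler_peMr ?ler0n.
  have J3 : J%:R <= 3 * (y * u) by lra.
  have kJ3 : k%:R * J%:R <= 3 * (k%:R * y * u).
    apply: le_trans (ler_wpM2l (ler0n _ _) J3) _.
    by rewrite le_eqVlt; apply/orP; left; apply/eqP; ring.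
  have : k%:R * y * u <= k%:R * y * u ^+ 3.
    rewrite exprS mulrA ler_peMr //; first by rewrite (le_trans _ z1).
    by rewrite exprn_ege1.
  have -> : 245 / c1 ^+ 3 * (k%:R * y) = 245 * (k%:R * y * u ^+ 3).
    by rewrite /u exprVn; ring.
  lra.
have os := star_minor_rejection_one_sided rej.
exists M; split=> //.
- apply: one_sided_tester os _ => x adm far; rewrite sample_tester_accept.
  have far' := far_dirty J0 kJ adm far; rewrite -/cap -/r in far'.
  set W := dirty _ _ _ x in far' *; pose p : R := #|W|%:R / N%:R; rewrite -/p.
  have N0 : 0 < N%:R :> R by rewrite (lt_le_trans _ N_ge1).
  have p01 : 0 <= p <= 1.
    rewrite divr_ge0 ?ler0n // ler_pdivrMr // mul1r ler_nat.
    by rewrite -[X in (_ <= X)%N]card_ord max_card.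
  (* [far_dirty] gives a density [p] above [eta / (2 * k * r)], and [t] is at least
     [4 * (k / eta) * r]. *)
  have tp : 2 <= t%:R * p.
    have /andP[p0 _] := p01.
    apply: le_trans (ler_wpM2r p0 t1); rewrite /p [X in _ <= X]mulrA ler_pdivlMr //.
    rewrite -yu -sqrtN2 -/r.
    have r0 : 0 < r by rewrite (lt_le_trans _ sqrtN_ge1).
    have -> : 4 * (k%:R / eta) * r * #|W|%:R = 2 * r / eta * (2 * k%:R * #|W|%:R).
      by field.
    have -> : 2 * (r * r) = 2 * r / eta * (eta * r) by field.
    by apply: ler_wpM2l; [rewrite !mulr_ge0 ?invr_ge0 // ltW|apply: ltW].
  have pt0 : 0 <= (1 - p) ^+ t by rewrite exprn_ge0 // subr_ge0; case/andP: p01.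
  have := exprB1_le t p01.
  have := ler_wpM2l pt0 (lerD (lexx 1) tp).
  lra.
- move=> x _ w _.
  apply: (@le_trans _ _ (t * ((2 * J).+1 * (cap * k)))%:R).
    by rewrite ler_nat nqueries_sample_run.
  (* The constant is 5 * 7 * 7, from [t <= 5 * y * u * r], [2 * J + 1 <= 7 * y * u] and
     [cap <= 7 * y * (y * u)]; the last factor [y] bounds [k]. *)
  have -> : 245 / c1 ^+ 3 * r * (k%:R / eps) ^+ 5 =
            5 * (y * u) * r * (7 * (y * u) * (7 * (y * (y * u)) * y)).
    by rewrite /u /y; field; rewrite ?ne_eps ?ne_c1.
  have J3 : J%:R <= 3 * (y * u) by lra.
  have r1 : 1 <= y * u * r by rewrite -[1]mulr1 ler_pM.
  rewrite !natrM; apply: ler_pM; rewrite ?mulr_ge0 //; first by lra.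
  rewrite -natr1 natrM; apply: ler_pM; rewrite ?addr_ge0 ?mulr_ge0 //; first by lra.
  apply: ler_pM => //; rewrite /cap natrD !natrM.
  have : k%:R * (2 * J%:R) <= y * (6 * (y * u)) by apply: ler_pM; rewrite ?mulr_ge0 //; lra.
  have : 1 <= y * (y * u) by rewrite -[1]mulr1 ler_pM.
  lra.
Qed.

End UpperBound.

Lemma upper_bound (R : realType) (c : R) : 0 < c ->
  exists (K : R) (a b : nat), forall (k N : nat) (eps : R),
     (3 <= k)%N -> (0 < N)%N -> 0 < eps ->
     exists M : ralg R N (option (graph 'I_N)),
       [/\ star_minor_tester c k eps (@accepts (graph 'I_N)) M,
           one_sided c k (@accepts (graph 'I_N)) M,
           makes_at_most c M
             (K * Num.sqrt N%:R * (1 + ln N%:R) ^+ a * (k%:R / eps) ^+ b) &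
           rejects_with_star_minor c k (K * (k%:R ^+ 2 / eps)) M].
Proof.
move=> c0; exists (245 / Num.min c 1 ^+ 3), 0%N, 5%N => k N eps k3 N0 e0.
have [e2|e2] := ltP eps (1 / 2).
  by rewrite expr0 mulr1; apply: small_eps_tester.
(* For [eps >= 1/2] no graph is far, and accepting without any query is correct. *)
have [M MO] := constant_tester R N (@None (graph 'I_N)).
have rej s : rejects_with_star_minor c k s M.
  by move=> x adm w _ F; rewrite MO.
exists M; split=> //; last first.
- move=> x _ w _; rewrite MO /= expr0 mulr1; apply: mulr_ge0.
    rewrite mulr_ge0 ?sqrtr_ge0 // divr_ge0 // exprn_ge0 //.
    by rewrite le_min (ltW c0) ler01.
  by rewrite exprn_ge0 // divr_ge0 // ltW.
- exact: star_minor_rejection_one_sided (rej 0).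
apply: one_sided_tester (star_minor_rejection_one_sided (rej 0)) _ => x _.
by move=> /(no_far_graph (leq_trans _ k3) e2)-/(_ isT).
Qed.

(** * The lower bound *)

Lemma input_of_lists N (nb : 'I_N -> seq 'I_N) :
  (forall v, uniq (nb v)) -> (forall v, v \notin nb v) ->
  (forall v w, w \in nb v -> v \in nb w) -> exists x : input N, nbrs x = nb.
Proof.
move=> nb_uniq nb_irr nb_sym.
pose E : {set {set 'I_N}} := [set e | [exists v, exists w in nb v, e == [set v; w]]].
have EP e : e \in E -> (e \subset [set: 'I_N]) && (#|e| == 2).
  rewrite inE => /existsP[v /exists_inP[w vw /eqP->]]; rewrite subsetT cards2.
  by case: (v =P w) vw => // <-; rewrite (negPf (nb_irr v)).
have nbE v w : (w \in nb v) = ([set v; w] \in E).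
  apply/idP/idP => [vw|]; rewrite inE.
    by apply/existsP; exists v; apply/exists_inP; exists w.
  move=> /existsP[a /exists_inP[b ab /eqP/set2_eq[][-> ->]]] //.
  exact: nb_sym.
by exists (@Input N (Graph EP) nb erefl nb_uniq nbE).
Qed.

(** * Cycles with a planted clique *)

Section CycleInputs.
Variable N : nat.
Hypothesis N_ge3 : (3 <= N)%N.
Implicit Types (v w : 'I_N) (A : {set 'I_N}).

Lemma ordS_neq v : ordS v != v.
Proof.
rewrite -val_eqE /=; have := ltn_ord v.
by rewrite leq_eqVlt => /orP[/eqP eN|lt]; [rewrite eN modnn|rewrite modn_small]; lia.
Qed.

Lemma ordSS_neq v : ordS (ordS v) != v.
Proof.
rewrite -val_eqE /= -addn1 modnDml addn1.
have := ltn_ord v; case: (ltnP v.+2 N) => h lt; first by rewrite modn_small; lia.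
have -> : v.+2 = ((v.+2 - N) + N)%N by lia.
by rewrite modnDr modn_small; lia.
Qed.

Definition cycle_nbrs v := [:: ordS v; ord_pred v].

Lemma mem_cycle_nbrs v w : (w \in cycle_nbrs v) = (w == ordS v) || (v == ordS w).
Proof.
rewrite !inE; congr (_ || _).
by rewrite -(can_eq (@ordSK N)) ord_predK eq_sym.
Qed.

(** Outside [A] the lists agree with those of the cycle, order included, so only queries at [A] can
    tell the two graphs apart. The empty [A] gives the cycle itself. *)
Definition planted_nbrs A v :=
  if v \in A then enum [set w | (w \in cycle_nbrs v) || (w \in A) && (w != v)]
  else cycle_nbrs v.

Lemma mem_planted_nbrs A v w : (w \in planted_nbrs A v) =
  (w \in cycle_nbrs v) || [&& v \in A, w \in A & w != v].
Proof.
rewrite /planted_nbrs; case: ifP => vA; last by rewrite andFb orbF.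
by rewrite mem_enum in_set.
Qed.

Lemma planted_input A : exists x : input N, nbrs x = planted_nbrs A.
Proof.
apply: input_of_lists => [v|v|v w].
- rewrite /planted_nbrs; case: ifP => _; first exact: enum_uniq.
  rewrite /= !inE andbT; apply: contraNneq (ordSS_neq v) => ->.
  by rewrite ord_predK.
- by rewrite mem_planted_nbrs mem_cycle_nbrs eq_sym (negPf (ordS_neq v)) eqxx !andbF.
rewrite !mem_planted_nbrs !mem_cycle_nbrs => /orP[/orP[->|->]|/and3P[-> -> wv]].
- by rewrite orbT.
- by [].
by rewrite [v == w]eq_sym wv !orbT.
Qed.

Section PlantedGraph.
Variables (A : {set 'I_N}) (x : input N).
Hypothesis xA : nbrs x = planted_nbrs A.

Lemma planted_edge v w : ([set v; w] \in eset (igraph x)) =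
  [|| w == ordS v, v == ordS w | [&& v \in A, w \in A & w != v]].
Proof. by rewrite -mem_nbrs xA mem_planted_nbrs mem_cycle_nbrs orbA. Qed.

Lemma planted_edges_ge : (N <= #|eset (igraph x)|)%N.
Proof.
rewrite -[X in (X <= _)%N]card_ord -(card_imset (f := fun v => [set v; ordS v])).
  apply/subset_leq_card/subsetP=> _ /imsetP[v _ ->].
  by rewrite planted_edge eqxx.
move=> v w /set2_eq[][//-> eq2].
by have := ordSS_neq w; rewrite eq2 eqxx.
Qed.

Lemma planted_edges_le : (#|eset (igraph x)| <= N + #|A| ^ 2)%N.
Proof.
rewrite -[X in (_ <= X + _)%N]card_ord -mulnn -cardsX.
rewrite -[X in (_ <= X + _)%N]cardsT.
apply: leq_trans (leq_add (leq_imset_card (fun v => [set v; ordS v]) _)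
  (leq_imset_card (fun p => [set p.1; p.2]) _)).
apply: leq_trans (leq_card_setU _ _).1; apply/subset_leq_card/subsetP=> e eG.
have /andP[_ /cards2P[v [w [_ eq_e]]]] := esetP eG.
rewrite eq_e planted_edge in eG *; rewrite inE.
case/or3P: eG => [/eqP->|/eqP->|/and3P[Av Aw _]]; apply/orP.
- by left; apply/imsetP; exists v.
- by left; apply/imsetP; exists w; rewrite // setUC.
by right; apply/imsetP; exists (v, w); rewrite // inE Av.
Qed.

(** A star-minor-free remainder has degrees at most [k], so at most [#|A| * k] of the pairs in [A]
    survive as edges; all others lie in [X]. *)
Lemma planted_far k (X : {set {set 'I_N}}) :
  star_minor_free k (remove_edges (igraph x) X) ->
  ('C(#|A|, 2) <= #|X| + #|A| * k)%N.
Proof.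
move=> free.
pose E := eset (remove_edges (igraph x) X).
have deg u : (#|[set w | [set u; w] \in E]| <= k)%N.
  rewrite leqNgt; apply/negP => lt; apply: free.
  apply: (@star_model_has_minor _ _ _ [set u] [set w | [set u; w] \in E]).
    by rewrite /= igraph_full.
  split; first exact: connects1.
  - by rewrite disjoints1 inE; apply/negP => /pair_edge[_ _]; rewrite eqxx.
  - exact: ltnW.
  by move=> w; rewrite in_set => uw; exists u; first exact: set11.
rewrite -cards_draws.
pose Q := \bigcup_(u in A) [set [set u; w] | w in [set w | [set u; w] \in E]].
have cQ : (#|Q| <= #|A| * k)%N.
  apply: card_bigcup_leq => v.
  exact: leq_trans (leq_imset_card _ _) (deg v).
apply: leq_trans (leq_add (leqnn _) cQ); apply: leq_trans (leq_card_setU _ _).1.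
apply/subset_leq_card/subsetP=> e; rewrite inE.
move=> /andP[/subsetP eA /cards2P[v [w [vw eq_e]]]].
have [Av Aw] : v \in A /\ w \in A by split; apply: eA; rewrite eq_e !inE eqxx ?orbT.
rewrite inE; case: (boolP (e \in X)) => //= eX; apply/bigcupP; exists v => //.
rewrite eq_e in eX *; apply: imset_f; rewrite !inE eX planted_edge Av Aw [w == v]eq_sym vw.
by rewrite !orbT.
Qed.

End PlantedGraph.

Lemma cycle_star_minor_free k (x : input N) : (3 <= k)%N ->
  nbrs x = planted_nbrs set0 -> star_minor_free k (igraph x).
Proof.
move=> k3 x0 /(has_minor_star_model (leq_trans _ k3))-/(_ isT)[S [L [cS dS kL adj]]].
have : (#|L| <= 2)%N; last by apply/negP; rewrite -ltnNge (leq_trans k3).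
apply: leq_trans (connects_boundary2 _ cS).
  apply/subset_leq_card/subsetP=> l Ll; rewrite inE (disjointFl dS Ll) /=.
  by have [u Su ul] := adj l Ll; apply/exists_inP; exists u.
move=> u; rewrite (@eq_card _ _ (mem (cycle_nbrs u))); first exact: card_size.
by move=> w; rewrite !inE -mem_nbrs x0 /planted_nbrs in_set0 !inE.
Qed.

End CycleInputs.

(** * Runs that leave a vertex set untouched *)

Section Untouched.
Variables (N : nat) (T : Type).
Implicit Types (t : dalg N T) (A : {set 'I_N}).

Definition query_vertex (q : query N) := match q with Nbr v _ => v | Deg v => v end.

Fixpoint touches t (x : input N) A : bool :=
  match t with
  | Output _ => false
  | Ask q next => (query_vertex q \in A) || touches (next (reply x q)) x A
  end.

Lemma eval_untouched t x y A : (forall v, v \notin A -> nbrs x v = nbrs y v) ->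
  ~~ touches t x A -> eval t x = eval t y.
Proof.
move=> xy; elim: t => //= q next IH; rewrite negb_or => /andP[qA /IH->].
have -> // : reply x q = reply y q.
by case: q qA {next IH} => [v i|v] /= /xy ->.
Qed.

(** Each query concerns one vertex, which lies in at most one of the disjoint sets. *)
Lemma sum_touches (I : finType) t x (A : I -> {set 'I_N}) :
  (forall v i j, v \in A i -> v \in A j -> i = j) ->
  (\sum_i touches t x (A i) <= nqueries t x)%N.
Proof.
move=> dA; elim: t => [a|q next IH] /=; first by rewrite big1.
have q1 : (\sum_i (query_vertex q \in A i) <= 1)%N.
  rewrite (eq_bigr (fun i => if query_vertex q \in A i then 1 else 0)%N) //.
  rewrite -big_mkcond sum1_card; apply/card_le1_eqP => i j.
  by rewrite !unfold_in => vi vj; apply: dA vj vi.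
apply: leq_trans (leq_add q1 (IH (reply x q))); rewrite -big_split /=.
by apply: leq_sum => i _; case: (_ \in _) => //=; case: touches.
Qed.

End Untouched.

Lemma nat_sqrt (n : nat) : exists m, (m ^ 2 <= n < m.+1 ^ 2)%N.
Proof.
elim: n => [|n [m /andP[h1 h2]]]; first by exists 0%N.
have [h|h] := ltnP n.+1 (m.+1 ^ 2); first by exists m; rewrite h (leq_trans h1).
by exists m.+1; rewrite h; nia.
Qed.

Lemma disjoint_blocks N m : (m ^ 2 <= N)%N -> exists A : 'I_m -> {set 'I_N},
  (forall i, #|A i| = m) /\ (forall v i j, v \in A i -> v \in A j -> i = j).
Proof.
move=> mN; have le : (#|{: 'I_m * 'I_m}| <= N)%N by rewrite card_prod card_ord mulnn.
(* The grid of pairs embeds into the vertices; the blocks are the images of its rows. *)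
pose f p : 'I_N := widen_ord le (enum_rank p).
have fi : injective f by move=> p q /(congr1 val)/= /val_inj/enum_rank_inj.
exists (fun i => [set f (i, j) | j : 'I_m]); split=> [i|v i j].
  by rewrite card_imset ?cardsT ?card_ord // => a b /fi[].
by move=> /imsetP[a _ ->] /imsetP[b _ /fi[]].
Qed.

(** Both inputs are run with the same seed: a seed accepting [x] but not [y] must query a vertex of
    [A] while running on [x]. *)
Lemma accept_prob_touches (R : realType) N (M : ralg R N bool) x y (A : {set 'I_N}) :
  (forall v, v \notin A -> nbrs x v = nbrs y v) ->
  accept_prob id M x <= accept_prob id M y +
    \sum_(w : seed M) prob w * (touches (run w) x A)%:R.
Proof.
move=> xy; rewrite /accept_prob big_mkcond [X in _ <= X + _]big_mkcond -big_split /=.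
apply: ler_sum => w _; have p0 := prob_ge0 w.
case: (boolP (touches _ _ _)) => [_|/(eval_untouched xy)->].
  by rewrite mulr1; case: ifP => _; case: ifP => _; lra.
by rewrite mulr0 addr0.
Qed.

Lemma lower_bound (R : realType) (c : R) : c <= 1 -> forall k : nat, (3 <= k)%N ->
  exists eps : R, 0 < eps /\
  exists (delta : R) (N0 : nat), 0 < delta /\
    forall (N : nat) (M : ralg R N bool) (q : R), (N0 <= N)%N ->
      star_minor_tester c k eps id M -> makes_at_most c M q ->
      delta * Num.sqrt N%:R <= q.
Proof.
(* For block size [m >= 4 * k + 3], at least [C(m, 2) - m * k >= m * (m + 1) / 4] edges must go,
   while there are at most [2 * m * (m + 1)] edges; so [#|E| < 50 * #|X|]. *)
move=> c1 k k3; exists (1 / 100); split; first by lra.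
(* The blocks give [m / 3 <= q], and [sqrt N <= m + 1 <= 2 * m] loses another factor 2. *)
exists (1 / 6), ((4 * k + 3) ^ 2)%N; split; first by lra.
move=> N M q N0 tester few.
have [m /andP[mN Nm]] := nat_sqrt N.
have km : (4 * k + 3 <= m)%N.
  by rewrite -ltnS -(ltn_exp2r _ _ (e := 2)) // (leq_ltn_trans N0).
have N3 : (3 <= N)%N by nia.
have [A [cA dA]] := disjoint_blocks mN.
have [x x0] := planted_input N3 set0.
have adm (y : input N) B : nbrs y = planted_nbrs B -> admissible c y.
  move=> yB; rewrite /admissible; apply: (@le_trans _ _ N%:R).
    by rewrite ler_piMl // ler0n.
  by rewrite ler_nat (planted_edges_ge N3 yB).
have [/(_ (cycle_star_minor_free k3 x0)) acc_x _] := tester x (adm x _ x0).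
pose P i := \sum_(w : seed M) prob w * (touches (run w) x (A i))%:R.
(* The cycle is accepted with probability at least 2/3, the graph planted on [A i] with at most 1/3;
   the gap is bounded by the probability of touching [A i] on the cycle. *)
have P3 i : 1 / 3 <= P i.
  have [y yA] := planted_input N3 (A i).
  have xy v : v \notin A i -> nbrs x v = nbrs y v.
    by move=> vA; rewrite x0 yA /planted_nbrs in_set0 (negPf vA).
  have [_ far_y] := tester y (adm y _ yA).
  have {}far_y : accept_prob id M y <= 1 / 3.
    apply: far_y => X sX free.
    have e1 := planted_edges_le yA; have e2 := planted_far yA free.
    rewrite !cA in e1 e2.
    have e3 : ('C(m, 2) * 2 = m * m.-1)%N.
      by have := bin_ffact m 2; rewrite ffactnS ffactn1.
    have e4 : (#|eset (igraph y)| < 50 * #|X|)%N by nia.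
    by move: e4; rewrite -(ltr_nat R) natrM; lra.
  have := accept_prob_touches M xy; rewrite -/(P i); lra.
(* Exchanging the sums, the expected number of blocks touched is at most the query bound on the
   cycle. *)
have : \sum_(i < m) P i <= q.
  rewrite /P exchange_big /= -[q]mul1r -[X in _ <= X * q](prob_sum1 M) mulr_suml.
  apply: ler_sum => w _; rewrite -mulr_sumr.
  have := prob_ge0 w; rewrite le_eqVlt => /orP[/eqP<-|w0]; first by rewrite !mul0r.
  rewrite ler_pM2l //; apply: le_trans (few x (adm x _ x0) w w0).
  by rewrite -natr_sum ler_nat; apply: sum_touches.
have : \sum_(i < m) (1 / 3 : R) <= \sum_(i < m) P i by apply: ler_sum => i _.
rewrite sumr_const card_ord -mulr_natr.
have : Num.sqrt N%:R <= m.+1%:R :> R.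
  rewrite -[leRHS]ger0_norm ?ler0n // -sqrtr_sqr ler_wsqrtr // -natrX ler_nat.
  exact: ltnW.
have : 1 <= m%:R :> R by rewrite ler1n; lia.
rewrite -[m.+1]addn1 natrD; lra.
Qed.

Theorem theorem8p2 (R : realType) (c : R) (hc : 0 < c) :
  (exists (K : R) (a b : nat), forall (k N : nat) (eps : R),
     (3 <= k)%N -> (0 < N)%N -> 0 < eps ->
     exists M : ralg R N (option (graph 'I_N)),
       [/\ star_minor_tester c k eps (@accepts (graph 'I_N)) M,
           one_sided c k (@accepts (graph 'I_N)) M,
           makes_at_most c M
             (K * Num.sqrt N%:R * (1 + ln N%:R) ^+ a * (k%:R / eps) ^+ b) &
           rejects_with_star_minor c k (K * (k%:R ^+ 2 / eps)) M])
  /\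
  (c <= 1 -> forall k : nat, (3 <= k)%N ->
     exists eps : R, 0 < eps /\
     exists (delta : R) (N0 : nat), 0 < delta /\
       forall (N : nat) (M : ralg R N bool) (q : R), (N0 <= N)%N ->
         star_minor_tester c k eps id M -> makes_at_most c M q ->
         delta * Num.sqrt N%:R <= q).
Proof. by split; [apply: upper_bound|apply: lower_bound]. Qed.
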